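(* Let an instance of the bi-objective BRT investment problem $\textsc{BRT}(\textsc{Linear}/Z=\infty/|M|=1)$ with $\tilde u_e=1$ for all $e\in E$ be given. Let $e_{(i)}$, $i\in\{1,\dots,n-1\}$, denote a sorting of the segments such that $c_{e_{(1)}}\le\dots\le c_{e_{(n-1)}}$. 1. Let $k\in\{0,\dots,n-1\}$. If $v=\sum_{i=1}^k c_{e_{(i)}}$ and $F=\{e_{(i)}: i\in\{1,\dots,k\}\}$, then $(F,v)$ is an efficient solution. 2. If there is some $\bar i\in\{1,\dots,n-1\}$ such that $c_{e_j}\ge c_{e_{j'}}$ for all $j\le j'\le\bar i$ and $c_{e_j}\le c_{e_{j'}}$ for all $\bar i\le j\le j'$, then for each non-dominated point there is some efficient solution $(F,v)$ attaining it (i.e. the non-dominated point equals $(p(F),v)$) such that all segments in $F$ are connected. 3. The instance can be solved in polynomial time, i.e. the set of all non-dominated points can be computed in polynomial time.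
   Context: An instance (with a single municipality, $|M|=1$, whose budget share is $1$, and with no constraint on the number of connected components, ''$Z=\infty$'') consists of: a linear graph $G=(V,E)$ with $V=\{1,\dots,n\}$, $n\in\mathbb N_{\ge1}$ (stations) and $E=\{e_i=\{i,i+1\}: i\in\{1,\dots,n-1\}\}$ (segments); upgrade costs $c_e\in\mathbb N_{\ge1}$ for $e\in E$; a set of OD pairs $D\subseteq\{(i,j):i,j\in V,i\neq j\}$, where $W_d\subseteq E$ denotes the edge set of the unique path from $i$ to $j$ in $G$ for $d=(i,j)\in D$; numbers of potential passengers $a_d\in\mathbb N_{\ge1}$ for $d\in D$; and infrastructure improvements $u_e\in\mathbb R_{>0}$ for $e\in E$. In Linear, the number of newly attracted passengers for $F\subseteq E$ is $p(F)=\sum_{d\in D}a_d\cdot\frac{\sum_{e\in F\cap W_d}u_e}{\sum_{e\in W_d}u_e}=\sum_{e\in F}\tilde u_e$, where $\tilde u_e:=u_e\cdot\sum_{d\in D:\,e\in W_d}\frac{a_d}{\sum_{e'\in W_d}u_{e'}}$ for $e\in E$. A pair $(F,v)$ with $F\subseteq E$, $v\in\mathbb R_{\ge0}$ is feasible if $\sum_{e\in F}c_e\le v$. The problem is to maximize $p(F)$ and minimize $v$ over feasible $(F,v)$. A feasible $(F,v)$ is efficient, and $(p(F),v)$ is called non-dominated, if there is no feasible $(F',v')$ with $p(F')\ge p(F)$, $v'\le v$ and at least one inequality strict. ''All segments in $F$ are connected'' means that the subgraph consisting of the edges in $F$ and their incident nodes has at most one connected component. *)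

(* Defs.v *)
From Corelib Require Import PosDef.
From HB Require Import structures.
From mathcomp Require Import all_boot all_order all_algebra.
From mathcomp Require Import boolp reals.

Set Implicit Arguments.
Unset Strict Implicit.
Unset Printing Implicit Defensive.
Import Order.TTheory GRing.Theory Num.Theory.
Local Open Scope ring_scope.

(** * Linear graphs *)

(* Stations and segments are numbered from 0: station x : 'I_n stands for
   x + 1, and segment e : 'I_n.-1, standing for e_(e+1), joins the stations
   x = e and x = e + 1. *)
Definition ends n (e : 'I_n.-1) : {set 'I_n} :=
  [set x : 'I_n | ((x : nat) == e) || ((x : nat) == e.+1)].

Definition adj n (F : {set 'I_n.-1}) : rel 'I_n :=
  [rel x y | [exists e in F, ends e == [set x; y]]].

Definition nodes n (F : {set 'I_n.-1}) : {set 'I_n} :=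
  \bigcup_(e in F) ends e.

Definition segments_connected n (F : {set 'I_n.-1}) : bool :=
  (n_comp (adj F) (nodes F) <= 1)%N.

(* [i :: p] is the vertex sequence of a simple path of the whole graph. *)
Definition simple_path n (i j : 'I_n) (p : seq 'I_n) : Prop :=
  [/\ path (adj [set: 'I_n.-1]) i p, last i p = j & uniq (i :: p)].

Definition traverses n (i : 'I_n) (p : seq 'I_n) (e : 'I_n.-1) : Prop :=
  exists2 xy, xy \in zip (i :: p) p & ends e = [set xy.1; xy.2].

(* The graph being a path, there is exactly one simple path from i to j. *)
Definition path_edges n (d : 'I_n * 'I_n) : {set 'I_n.-1} :=
  [set e | `[< exists2 p, simple_path d.1 d.2 p & traverses d.1 p e >]].

(** * The bi-objective investment problem BRT(Linear / Z = oo / |M| = 1) *)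

(* [passengers] is only meaningful on the pairs in [od]. *)
Record instance (R : realType) := Instance {
  stations : nat;
  cost : 'I_stations.-1 -> nat;
  od : {set 'I_stations * 'I_stations};
  passengers : 'I_stations * 'I_stations -> nat;
  improvement : 'I_stations.-1 -> R;
  stations_gt0 : (0 < stations)%N;
  cost_gt0 : forall e, (0 < cost e)%N;
  od_neq : forall d, d \in od -> d.1 != d.2;
  passengers_gt0 : forall d, d \in od -> (0 < passengers d)%N;
  improvement_gt0 : forall e, 0 < improvement e
}.

Section Problem.
Variables (R : realType) (I : instance R).
Local Notation segment := 'I_(stations I).-1.
Implicit Types (F : {set segment}) (v x y : R).

Definition attracted F : R :=
  \sum_(d in od I) (passengers d)%:R *
    ((\sum_(e in F :&: path_edges d) improvement e) /
     (\sum_(e in path_edges d) improvement e)).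

Definition weight (e : segment) : R :=
  improvement e *
    \sum_(d in od I | e \in path_edges d)
       ((passengers d)%:R / \sum_(e' in path_edges d) improvement e').

Definition feasible F v : Prop :=
  0 <= v /\ \sum_(e in F) (cost e)%:R <= v.

Definition efficient F v : Prop :=
  feasible F v /\
  ~ exists F' v', [/\ feasible F' v', attracted F <= attracted F', v' <= v
                    & attracted F < attracted F' \/ v' < v].

Definition nondominated x y : Prop :=
  exists F v, [/\ efficient F v, x = attracted F & y = v].

End Problem.

(** * Deterministic multitape Turing machines *)

Inductive shift := ShiftLeft | Stay | ShiftRight.

(* The tape alphabet consists of the input/output alphabet [A], of the
   auxiliary symbols, and of the blank [None]. *)
Record machine (A : finType) := Machine {
  state : finType;
  aux : finType;
  ntapes' : nat;
  start : state;
  halting : pred state;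
  trans : state -> {ffun 'I_ntapes'.+1 -> option (A + aux)} ->
          state * {ffun 'I_ntapes'.+1 -> option (A + aux) * shift}
}.

Section Run.
Variables (A : finType) (M : machine A).

Definition cell := option (A + aux M).

(* (l, r) is the two-way infinite tape ...blank, rev l, r, blank...,
   whose head scans the first cell of r. *)
Definition tape := (seq cell * seq cell)%type.

Definition scanned (t : tape) : cell := head None t.2.

Definition update (t : tape) (c : cell) (s : shift) : tape :=
  let r := behead t.2 in
  match s with
  | ShiftLeft => (behead t.1, head None t.1 :: c :: r)
  | Stay => (t.1, c :: r)
  | ShiftRight => (c :: t.1, r)
  end.

Definition config := (state M * {ffun 'I_(ntapes' M).+1 -> tape})%type.

Definition step (c : config) : config :=
  if halting c.1 then c else
  let: (q, w) := trans c.1 [ffun i => scanned (c.2 i)] in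
  (q, [ffun i => update (c.2 i) (w i).1 (w i).2]).

Definition symbols (w : seq A) : seq cell := [seq Some (inl a) | a <- w].

(* The input is on the first tape, the output on the last one. *)
Definition initial (w : seq A) : config :=
  (start M, [ffun i => ([::], if i == ord0 then symbols w else [::])]).

Definition tape_holds (t : tape) (z : seq A) : Prop :=
  exists a b, rev t.1 ++ t.2 = nseq a None ++ symbols z ++ nseq b None.

Definition outputs_within (w : seq A) (t : nat) (z : seq A) : Prop :=
  let c := iter t step (initial w) in
  halting c.1 /\ tape_holds (c.2 ord_max) z.

End Run.

(* The search problem asking, on the inputs [x] satisfying the promise [P],
   given through their code [enc x], for a word [z] such that [sol x z]. *)
Definition poly_time_solvable (A : finType) (X : Type) (P : X -> Prop)
    (enc : X -> seq A) (sol : X -> seq A -> Prop) : Prop :=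
  exists (M : machine A) (q : {poly nat}),
    forall x, P x ->
      exists t z, [/\ (t <= q.[size (enc x)])%N,
                      outputs_within M (enc x) t z & sol x z].

(** * Encodings *)

Definition symbol : finType := (bool + bool)%type.
Definition bit (b : bool) : symbol := inl b.
Definition comma : symbol := inr false.
Definition semicolon : symbol := inr true.

(* Binary notation, least significant bit first, without leading zeros
   (so that 0 is the empty word). *)
Fixpoint bits_of_pos (p : positive) : seq bool :=
  match p with
  | xH => [:: true]
  | xO p' => false :: bits_of_pos p'
  | xI p' => true :: bits_of_pos p'
  end.

Definition bits_of_nat (n : nat) : seq bool :=
  if bin_of_nat n is Npos p then bits_of_pos p else [::].

Definition field (w : seq bool) : seq symbol := rcons (map bit w) comma.

Definition number (n : nat) : seq symbol := field (bits_of_nat n).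

(* Real numbers have no canonical finite code: [rho] is the scheme by which
   the infrastructure improvements are written down.  On the rationals, it may
   be taken to be any of the usual injective codes. *)
Definition encode_instance (R : realType) (rho : R -> seq bool)
    (I : instance R) : seq symbol :=
  number (stations I) ++ semicolon ::
  flatten [seq number (cost e) | e : 'I_(stations I).-1] ++ semicolon ::
  flatten [seq field (rho (improvement e)) | e : 'I_(stations I).-1] ++
    semicolon ::
  flatten [seq number d.1 ++ number d.2 ++ number (passengers d)
          | d : 'I_(stations I) * 'I_(stations I) <- enum (od I)].

Definition encode_points (s : seq (nat * nat)) : seq symbol :=
  flatten [seq number pv.1 ++ number pv.2 | pv <- s].

(* When all weights are 1, the non-dominated points have natural coordinates,
   and can thus be listed as pairs of binary numbers. *)
Definition lists_nondominated (R : realType) (I : instance R)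
    (z : seq symbol) : Prop :=
  exists2 s, z = encode_points s &
    forall x y : R, nondominated I x y <->
      exists2 pv, pv \in s & x = pv.1%:R /\ y = pv.2%:R.

(* Main.v *)
(** With unit weights, [F] attracts [#|F|] passengers, so a non-dominated point
    is a cardinality [k] together with the cost of the [k] cheapest segments,
    and a set is efficient as soon as none of its segments is dearer than a
    segment outside of it.  If the costs first decrease and then increase, such
    sets can be grown as intervals around the valley, adding at each step the
    cheaper of the two neighbouring segments.

    A Turing machine need not sort: for each cost [c_j], it scans all the costs
    and counts and adds those which precede it in the order of the pairs
    [(c_i, i)].  As this order is total, every positive cardinality occurs as
    the rank of some [j].  Each of the quadratically many comparisons and
    additions is linear in the number of bits. *)

Require Import Defs.
From HB Require Import structures.
From mathcomp Require Import all_boot all_order all_algebra all_fingroup.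
From mathcomp Require Import boolp reals.
From mathcomp Require Import zify.

Set Implicit Arguments.
Unset Strict Implicit.
Unset Printing Implicit Defensive.
Import Order.TTheory GRing.Theory Num.Theory.

(** The obstacle is the machine model: polynomial-time solvability asks for one explicit transition
    function on tapes given as finite lists. Programs are therefore written in a small structured
    language whose control points become the states, and each is specified by a triple with a time
    bound, [exec p n s s']. For such triples to compose by plain equality, a tape is a pair of
    functions, so that written and missing blanks coincide; lists reappear only at the input and the
    output. Tape 0 carries the input, tape 1 a copy of the costs, tapes 2 and 3 the count and the
    total, tape 4 a flag that serves as verdict and as carry, tape 5 the output. Since 0 is the
    empty word, a blank tape is a counter holding 0 and a blank flag is an undecided verdict or an
    absent carry, so erasing is all the initialisation needed between rounds. All time bounds follow
    from one number [B], the length of the coded list of costs: every count and every sum stays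
    below [2 ^ B]. *)

Definition glyph : Type := option (symbol + void).

(* A tape up to trailing blanks: infinitely many cells on either side. *)
Definition track : Type := ((nat -> glyph) * (nat -> glyph))%type.

Definition trk (l r : seq glyph) : track := (nth None l, nth None r).

Definition scan (t : track) : glyph := t.2 0%N.

Definition rewrite_cell (t : track) (c : glyph) (d : shift) : track :=
  match d with
  | ShiftLeft => (fun i => t.1 i.+1,
      fun i => match i with 0 => t.1 0 | 1 => c | i'.+1 => t.2 i' end)
  | Stay => (t.1, fun i => if i is 0 then c else t.2 i)
  | ShiftRight => (fun i => if i is i'.+1 then t.1 i' else c,
                   fun i => t.2 i.+1)
  end%N.

Arguments scan : simpl never.
Arguments rewrite_cell : simpl never.

Lemma trk_eq l r l' r' :
  nth None l =1 nth None l' -> nth None r =1 nth None r' -> trk l r = trk l' r'.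
Proof. by move=> El Er; rewrite /trk (funext El) (funext Er). Qed.

Lemma trk_headl l r : trk (head None l :: behead l) r = trk l r.
Proof. by apply: trk_eq => // i; case: l => //; case: i => [|[]]. Qed.

Lemma trk_headr l r : trk l (head None r :: behead r) = trk l r.
Proof. by apply: trk_eq => // i; case: r => //; case: i => [|[]]. Qed.

Lemma trk_blankl n r : trk (nseq n None) r = trk [::] r.
Proof. by apply: trk_eq => // i; rewrite nth_nseq if_same nth_nil. Qed.

Lemma trk_left l r c :
  rewrite_cell (trk l r) c ShiftLeft
    = trk (behead l) (head None l :: c :: behead r).
Proof.
congr pair; apply: funext => i /=; first by rewrite nth_behead.
by case: i => [|[|i]] //=; rewrite ?nth0 // nth_behead.
Qed.

Lemma trk_stay l r c : rewrite_cell (trk l r) c Stay = trk l (c :: behead r).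
Proof. by congr pair; apply: funext => -[|i] //=; rewrite nth_behead. Qed.

Lemma trk_right l r c :
  rewrite_cell (trk l r) c ShiftRight = trk (c :: l) (behead r).
Proof. by congr pair; apply: funext => i; rewrite /= ?nth_behead //;
  case: i. Qed.

Definition trkE := (trk_left, trk_stay, trk_right).

(** * Structured programs *)

(* An action lists what each tape does: [None] leaves the tape alone. *)
Definition action : Type := seq (option (glyph * shift)).

Inductive prog :=
| Do (f : seq glyph -> action)
| Seq (p q : prog)
| While (b : seq glyph -> bool) (p : prog)
| If (b : seq glyph -> bool) (p q : prog).

(** [None] is the state in which the test of a loop or of a conditional is evaluated, at the price
    of one idle step. For a loop it is also what [next] returns when the body exits, so the body
    falls back on the test by itself. *)
Fixpoint control (p : prog) : finType :=
  match p with
  | Do _ => unit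
  | Seq p q => (control p + control q)%type
  | While _ p => option (control p)
  | If _ p q => option (control p + control q)
  end.

Fixpoint entry (p : prog) : control p :=
  match p with
  | Do _ => tt
  | Seq p _ => inl (entry p)
  | While _ _ => None
  | If _ _ _ => None
  end.

(* The next control state is [None] when the program exits. *)
Fixpoint next (p : prog) : control p -> seq glyph -> option (control p) :=
  match p with
  | Do _ => fun _ _ => None
  | Seq p q => fun x w =>
      match x with
      | inl y => Some (if next y w is Some z then inl z else inr (entry q))
      | inr y => omap inr (next y w)
      end
  | While b p => fun x w =>
      if x is Some y then Some (next y w)
      else if b w then Some (Some (entry p)) else None
  | If b p q => fun x w =>
      match x with
      | None => Some (Some (if b w then inl (entry p) else inr (entry q)))
      | Some (inl y) => omap (Some \o inl) (next y w)
      | Some (inr y) => omap (Some \o inr) (next y w)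
      end
  end.

Fixpoint act (p : prog) : control p -> seq glyph -> action :=
  match p with
  | Do f => fun _ w => f w
  | Seq p q => fun x w => match x with inl y => act y w | inr y => act y w end
  | While b p => fun x w => if x is Some y then act y w else [::]
  | If b p q => fun x w =>
      match x with
      | None => [::]
      | Some (inl y) => act y w
      | Some (inr y) => act y w
      end
  end.

Fixpoint perform (a : action) (s : seq track) : seq track :=
  match a, s with
  | o :: a', t :: s' =>
      (if o is Some (c, d) then rewrite_cell t c d else t) :: perform a' s'
  | _, _ => s
  end.

Lemma perform_nil s : perform [::] s = s. Proof. by case: s. Qed.

Lemma size_perform a s : size (perform a s) = size s.
Proof. by elim: a s => [|o a IH] [|t s] //=; rewrite IH. Qed.

Lemma nth_perform t0 a s i : (i < size s)%N ->
  nth t0 (perform a s) i =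
    if nth None a i is Some (c, d) then rewrite_cell (nth t0 s i) c d
    else nth t0 s i.
Proof.
elim: a s i => [|o a IH] [|t s] [|i] //= lt_i_s.
exact: IH.
Qed.

Inductive exits (p : prog) : nat -> control p -> seq track ->
  seq track -> Prop :=
| exits_now x s : next x (map scan s) = None ->
    exits 1 x s (perform (act x (map scan s)) s)
| exits_later n x y s s' : next x (map scan s) = Some y ->
    exits n y (perform (act x (map scan s)) s) s' -> exits n.+1 x s s'.

(** Only an upper bound on the time, so that running times can be rounded up at each stage. *)
Definition exec (p : prog) (n : nat) (s s' : seq track) : Prop :=
  exists2 m, (m <= n)%N & exits m (entry p) s s'.

Lemma exec_le p m n s s' : exec p m s s' -> (m <= n)%N -> exec p n s s'.
Proof. by case=> k le_km ? le_mn; exists k => //; apply: leq_trans le_mn. Qed.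

Lemma exec_do f s s' : perform (f (map scan s)) s = s' -> exec (Do f) 1 s s'.
Proof. by move=> <-; exists 1%N => //; apply: (@exits_now (Do f)). Qed.

Lemma exits_seqr p q n x s s' :
  exits n x s s' -> exits n (inr x : control (Seq p q)) s s'.
Proof.
elim=> {n x s s'} [x s Ex | n x y s s' Ex _ IH].
  by apply: (@exits_now (Seq p q) (inr x)); rewrite /= Ex.
by apply: (@exits_later (Seq p q) _ _ (inr y)); [rewrite /= Ex | apply: IH].
Qed.

(** The step that leaves [p] already enters [q], so sequencing adds no step. *)
Lemma exits_seql p q m n x s s1 s' : exits m x s s1 ->
  exits n (entry q) s1 s' -> exits (m + n) (inl x : control (Seq p q)) s s'.
Proof.
elim=> {m x s s1} [x s Ex | m x y s s1 Ex _ IH] Hq.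
  apply: (@exits_later (Seq p q) _ _ (inr (entry q)));
    last exact: exits_seqr Hq.
  by rewrite /= Ex.
by apply: (@exits_later (Seq p q) _ _ (inl y)); [rewrite /= Ex | apply: IH].
Qed.

Lemma exec_seq p q m n s s1 s' :
  exec p m s s1 -> exec q n s1 s' -> exec (Seq p q) (m + n) s s'.
Proof.
case=> k le_km Hp [l le_ln Hq]; exists (k + l)%N; first exact: leq_add.
exact: exits_seql Hp Hq.
Qed.

Lemma exec_if b p q n s s' :
  exec (if b (map scan s) then p else q) n s s' -> exec (If b p q) n.+1 s s'.
Proof.
case=> k le_kn Hk; exists k.+1 => //.
pose x : control (If b p q) :=
  Some (if b (map scan s) then inl (entry p) else inr (entry q)).
apply: (@exits_later (If b p q) _ _ x) => //; rewrite perform_nil {}/x.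
case: (b _) Hk => {le_kn}; elim=> {k s s'} [y s Ey | k y z s s' Ey _ IH].
- by apply: (@exits_now (If b p q) (Some (inl y))); rewrite /= Ey.
- apply: (@exits_later (If b p q) _ _ (Some (inl z))); last exact: IH.
  by rewrite /= Ey.
- by apply: (@exits_now (If b p q) (Some (inr y))); rewrite /= Ey.
- apply: (@exits_later (If b p q) _ _ (Some (inr z))); last exact: IH.
  by rewrite /= Ey.
Qed.

Lemma exec_while_stop b p s : ~~ b (map scan s) -> exec (While b p) 1 s s.
Proof.
move=> /negPf Eb; exists 1%N => //.
have := @exits_now (While b p) None s; rewrite perform_nil; apply.
by rewrite /= Eb.
Qed.

Lemma exec_while_loop (b : seq glyph -> bool) p m n s s1 s' :
  b (map scan s) -> exec p m s s1 ->
  exec (While b p) n s1 s' -> exec (While b p) (m + n).+1 s s'.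
Proof.
move=> Eb [k le_km Hp] [l le_ln Hw]; exists (k + l).+1.
  by rewrite ltnS leq_add.
apply: (@exits_later (While b p) _ _ (Some (entry p))); first by rewrite /= Eb.
rewrite perform_nil; elim: Hp Hw =>
  {Eb le_km k s s1} [x s Ex|k x y s s1 Ex _ IH].
  move=> Hw; apply: (@exits_later (While b p) _ _ None); last exact: Hw.
  by rewrite /= Ex.
move=> Hw; apply: (@exits_later (While b p) _ _ (Some y)); last exact: IH.
by rewrite /= Ex.
Qed.

(** * Compilation of programs into Turing machines *)

Lemma nth_image_ord (X : Type) x0 n (f : 'I_n -> X) (i : 'I_n) :
  nth x0 [seq f j | j : 'I_n] i = f i.
Proof. by rewrite (nth_map i) ?size_enum_ord // nth_ord_enum. Qed.

(** The exit [None] of [next] is the halting state, so the machine and the program advance in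
    lockstep. A machine writes on every tape at every step; leaving a tape alone becomes rewriting
    its scanned cell in place, which may lengthen the list by a blank but not change the track. *)
Definition machine_of (k : nat) (p : prog) : machine symbol :=
  @Machine symbol (option (control p)) void k (Some (entry p))
    (fun x => x == None)
    (fun x w => let g := [seq w i | i : 'I_k.+1] in
       (if x is Some y then next y g else None,
        [ffun i : 'I_k.+1 =>
          odflt (w i, Stay)
            (if x is Some y then nth None (act y g) i else None)])).

Lemma step_machine k p (x : control p) s
    (T : {ffun 'I_k.+1 -> tape (machine_of k p)}) :
  s = [seq trk (T i).1 (T i).2 | i : 'I_k.+1] ->
  exists2 T' : {ffun 'I_k.+1 -> tape (machine_of k p)},
    step (M := machine_of k p) (Some x, T) = (next x (map scan s), T')
    & perform (act x (map scan s)) s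
        = [seq trk (T' i).1 (T' i).2 | i : 'I_k.+1].
Proof.
move=> Es; pose g : {ffun 'I_k.+1 -> glyph} := [ffun j => scanned (T j)].
have Eg : map scan s = [seq g i | i : 'I_k.+1].
  by rewrite Es -map_comp; apply: eq_map => i;
    rewrite /= ffunE /scan /scanned -[LHS]nth0.
rewrite {}Eg; eexists; first by rewrite /step /=; reflexivity.
apply: (@eq_from_nth _ (trk [::] [::])) => [|i].
  by rewrite size_perform Es !size_map.
rewrite size_perform => lt_i; rewrite nth_perform // Es.
rewrite Es size_map size_enum_ord in lt_i.
rewrite -[i]/(nat_of_ord (Ordinal lt_i)) !nth_image_ord !ffunE.
set o := nth None _ _; case: o => [[c d]|] /=.
  by case: d; rewrite trkE.
by rewrite trk_headr.
Qed.

Lemma exits_iter k p n (x : control p) s s'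
    (T : {ffun 'I_k.+1 -> tape (machine_of k p)}) :
  exits n x s s' -> s = [seq trk (T i).1 (T i).2 | i : 'I_k.+1] ->
  exists2 T' : {ffun 'I_k.+1 -> tape (machine_of k p)},
    iter n (@step _ (machine_of k p)) (Some x, T) = (None, T')
    & s' = [seq trk (T' i).1 (T' i).2 | i : 'I_k.+1].
Proof.
move=> Hx; elim: Hx T => {n x s s'} [x s Ex|n x y s s' Ex _ IH] T Es.
  have [T1 E1 Es1] := step_machine x Es.
  by exists T1; rewrite //= E1 Ex.
have [T1 E1 Es1] := step_machine x Es.
have [T' ET' Es'] := IH _ Es1.
by exists T'; rewrite // iterSr E1 Ex.
Qed.

(** This is the way back from tracks to lists: a word without blanks is determined by its track up
    to trailing blanks, exactly the freedom allowed by [tape_holds]. *)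
Lemma nth_blank_cat (w l : seq glyph) :
  all isSome w -> nth None l =1 nth None w -> exists b, l = w ++ nseq b None.
Proof.
elim: w l => [|c w IH] l /=.
  move=> _ El; exists (size l); apply: (@eq_from_nth _ None) => [|i lt_i].
    by rewrite size_nseq.
  by rewrite El nth_nseq nth_nil if_same.
case: c => // c w_some; case: l => [/(_ 0%N) //|c' l] El.
have /= -> := El 0; have [|b ->] := IH l w_some; last by exists b.
by move=> i; have := El i.+1.
Qed.

Definition glyphs (w : seq symbol) : seq glyph := [seq Some (inl a) | a <- w].

Lemma exec_outputs k p n w z s :
  exec p n (trk [::] (glyphs w) :: nseq k (trk [::] [::])) s ->
  last (trk [::] [::]) s = trk (rev (glyphs z)) [::] ->
  exists2 t, (t <= n)%N & outputs_within (machine_of k p) w t z.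
Proof.
case=> m le_mn Hp Hz; exists m => //.
set c := initial (machine_of k p) w.
have Ec : trk [::] (glyphs w) :: nseq k (trk [::] [::])
    = [seq trk (c.2 i).1 (c.2 i).2 | i : 'I_k.+1].
  apply: (@eq_from_nth _ (trk [::] [::])) => [|i].
    by rewrite /= size_nseq size_map size_enum_ord.
  rewrite /= size_nseq => lt_i.
  rewrite -[i in RHS]/(nat_of_ord (Ordinal lt_i)) nth_image_ord.
  by rewrite ffunE; case: i lt_i => [|i] //= lt_i; rewrite nth_nseq; case: ifP.
have [T ET Es] := exits_iter Hp Ec.
rewrite /outputs_within -/c [c]surjective_pairing ET; split=> //=.
have : trk (T ord_max).1 (T ord_max).2 = trk (rev (glyphs z)) [::].
  rewrite -Hz Es (last_nth (trk [::] [::])) size_map size_enum_ord /=.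
  by rewrite (nth_image_ord _ _ (ord_max : 'I_k.+1)).
case=> El Er.
have [|i|a Ea] := @nth_blank_cat (rev (glyphs z)) (T ord_max).1.
- by rewrite /glyphs -map_rev all_map all_predT.
- by rewrite El.
have [|i|b Eb] := @nth_blank_cat [::] (T ord_max).2; rewrite ?Er //.
by exists a, b; rewrite Ea Eb /= rev_cat revK rev_nseq -catA.
Qed.

(** * Binary numbers *)

Definition bval (w : seq bool) : nat :=
  foldr (fun (b : bool) n => b + n.*2) 0 w.

(** With the least significant bit first, a leading zero is a last bit [false]. The default [true]
    admits the empty word, the code of 0. *)
Definition trimmed (w : seq bool) : bool := last true w.

Lemma trimmed_cons b w :
  trimmed (b :: w) = ((w == [::]) ==> b) && trimmed w.
Proof. by case: w => [|c w]; rewrite /trimmed /= ?andbT. Qed.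

Lemma bval_eq0 w : trimmed w -> bval w = 0 -> w = [::].
Proof.
elim: w => //= b w IH; rewrite trimmed_cons => /andP[Eb /IH{}IH] E0.
have Ew : w = [::] by apply: IH; lia.
by move: Eb E0; rewrite Ew eqxx; case: b.
Qed.

Lemma bval_inj u w : trimmed u -> trimmed w -> bval u = bval w -> u = w.
Proof.
elim: u w => [|a u IH] w Cu Cw Euw; first by rewrite [w]bval_eq0.
case: w Cw Euw => [|b w] Cw; first by move/(bval_eq0 Cu).
move: Cu Cw; rewrite !trimmed_cons => /andP[_ Cu] /andP[_ Cw] /= Eab.
by rewrite (IH w) //; [congr cons|]; case: a Eab; case: b; lia.
Qed.

Lemma bval_bits n : bval (bits_of_nat n) = n.
Proof.
rewrite /bits_of_nat -[RHS]bin_of_natK; case: (bin_of_nat n) => //= p.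
by elim: p => //= p ->; rewrite ?NatTrec.doubleE.
Qed.

Lemma trimmed_bits n : trimmed (bits_of_nat n).
Proof.
rewrite /bits_of_nat; case: (bin_of_nat n) => //= p.
by elim: p => //= p IH; rewrite trimmed_cons IH andbT; case: p {IH}.
Qed.

(** Arithmetic on the tape only yields some word with the right value; being trimmed identifies it
    with the canonical code. *)
Lemma bits_bval w : trimmed w -> w = bits_of_nat (bval w).
Proof.
by move=> Cw; apply: bval_inj; rewrite ?trimmed_bits ?bval_bits.
Qed.

Lemma bval_lt w : bval w < 2 ^ size w.
Proof. by elim: w => //= b w; rewrite expnS; case: b; lia. Qed.

(** The top bit of a nonzero number is 1, so it alone contributes half of [2 ^ size]. *)
Lemma exp_size_bits n : n = 0 \/ 2 ^ size (bits_of_nat n) <= n.*2.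
Proof.
rewrite -{1 3}[n]bval_bits; have := trimmed_bits n.
elim: (bits_of_nat n) => [|b w IH]; first by left.
rewrite trimmed_cons => /andP[Eb Cw]; right => /=; rewrite expnS.
case: (IH Cw) => [/(bval_eq0 Cw) Ew|]; last by lia.
by move: Eb; rewrite Ew eqxx /=; case: b.
Qed.

Lemma size_bits n m : n < 2 ^ m -> size (bits_of_nat n) <= m.
Proof.
move=> lt_n_2m; case: (exp_size_bits n) => [-> //|le_2s].
by rewrite -ltnS -(ltn_exp2l (m := 2)) // expnS; lia.
Qed.

(** * Elementary programs *)

Definition bitg (b : bool) : glyph := Some (inl (bit b)).
Definition commag : glyph := Some (inl comma).
Definition semig : glyph := Some (inl semicolon).

Definition is_blank (c : glyph) : bool := if c is None then true else false.
Definition is_bit (c : glyph) : bool :=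
  if c is Some (inl (inl _)) then true else false.
Definition is_comma (c : glyph) : bool :=
  if c is Some (inl (inr b)) then ~~ b else false.
Definition is_semi (c : glyph) : bool :=
  if c is Some (inl (inr b)) then b else false.
Definition bit_of (c : glyph) : bool :=
  if c is Some (inl (inl b)) then b else false.

Definition num (n : nat) : seq glyph := map bitg (bits_of_nat n).

Definition put (i : nat) (c : glyph) (d : shift) : prog :=
  Do (fun=> ncons i None [:: Some (c, d)]).

Definition move (i : nat) (d : shift) : prog :=
  Do (fun g => ncons i None [:: Some (nth None g i, d)]).

Definition advance (i : nat) (p : pred glyph) : prog :=
  While (fun g => p (nth None g i)) (move i ShiftRight).

(* Moves left to the first cell of the block which follows the nearest cell
   satisfying [p]. *)
Definition rewind (i : nat) (p : pred glyph) : prog :=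
  Seq (move i ShiftLeft)
    (Seq (While (fun g => ~~ p (nth None g i)) (move i ShiftLeft))
      (move i ShiftRight)).

Lemma nth_scan s1 t s2 : nth None (map scan (s1 ++ t :: s2)) (size s1) = scan t.
Proof. by rewrite map_cat nth_cat size_map ltnn subnn. Qed.

Lemma perform_at s1 t s2 c d :
  perform (ncons (size s1) None [:: Some (c, d)]) (s1 ++ t :: s2)
    = s1 ++ rewrite_cell t c d :: s2.
Proof. by elim: s1 => [|t' s1 IH] /=; [case: s2 | rewrite IH]. Qed.

Lemma exec_put s1 t s2 c d :
  exec (put (size s1) c d) 1 (s1 ++ t :: s2) (s1 ++ rewrite_cell t c d :: s2).
Proof. by apply: exec_do; rewrite perform_at. Qed.

Lemma exec_move s1 t s2 d :
  exec (move (size s1) d) 1 (s1 ++ t :: s2)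
    (s1 ++ rewrite_cell t (scan t) d :: s2).
Proof. by apply: exec_do; rewrite nth_scan perform_at. Qed.

Lemma scan_trk l r : scan (trk l r) = head None r.
Proof. by rewrite -nth0. Qed.

Lemma exec_advance p w s1 l r s2 : all p w -> ~~ p (head None r) ->
  exec (advance (size s1) p) (2 * size w).+1
    (s1 ++ trk l (w ++ r) :: s2) (s1 ++ trk (rev w ++ l) r :: s2).
Proof.
move=> + Hr; elim: w l => [|c w IH] l.
  by move=> _; apply: exec_while_stop; rewrite nth_scan scan_trk.
case/andP=> pc pw; rewrite rev_cons cat_rcons.
have -> : (2 * size (c :: w)).+1 = (1 + (2 * size w).+1).+1 by rewrite /=; lia.
apply: exec_while_loop (IH _ pw); first by rewrite nth_scan.
by have := exec_move s1 (trk l ((c :: w) ++ r)) s2 ShiftRight; rewrite trkE.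
Qed.

Lemma trk_cat_headr l w r :
  trk l (w ++ head None r :: behead r) = trk l (w ++ r).
Proof.
case: r => // /=; apply: trk_eq => // i.
by rewrite cats0 nth_cat; case: ltnP => // /(nth_default _) ->;
  case: (_ - _) => [|[]].
Qed.

Lemma exec_rewind p w s1 l r s2 :
  all (predC p) w -> p (head None l) ->
  exec (rewind (size s1) p) (2 * size w + 3)
    (s1 ++ trk (rev w ++ l) r :: s2) (s1 ++ trk l (w ++ r) :: s2).
Proof.
move=> Hw Hl; have -> : 2 * size w + 3 = 1 + ((2 * size w).+1 + 1) by lia.
apply: exec_seq; first exact: exec_move.
rewrite scan_trk trkE (trk_cat_headr _ [:: _]); apply: (@exec_seq _ _ _ _ _
    (s1 ++ trk (behead l) (head None l :: w ++ r) :: s2)); last first.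
  have := exec_move s1 (trk (behead l) (head None l :: w ++ r)) s2 ShiftRight.
  by rewrite trkE trk_headl.
elim/last_ind: w r Hw => [|w c IH] r.
  by move=> _; apply: exec_while_stop; rewrite nth_scan scan_trk negbK.
rewrite all_rcons rev_rcons size_rcons => /andP[/= pc pw].
have -> : (2 * (size w).+1).+1 = (1 + (2 * size w).+1).+1 by lia.
rewrite cat_rcons; apply: exec_while_loop (IH _ pw).
  by rewrite nth_scan.
by have := exec_move s1 (trk (rev w ++ l) (c :: r)) s2 ShiftLeft; rewrite trkE.
Qed.

Lemma trk_blank1 l : trk l [:: None] = trk l [::].
Proof. exact: (trk_headr l [::]). Qed.

Lemma rev_consE (T : Type) (x : T) s t : rev (x :: s) ++ t = rev s ++ x :: t.
Proof. by rewrite rev_cons cat_rcons. Qed.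

(** The head waits at the end of the shorter number, where [bit_of] keeps supplying zeros; this pads
    both numbers to the same length. *)
Definition step_if_bit (c : glyph) : option (glyph * shift) :=
  Some (c, if is_bit c then ShiftRight else Stay).

(* Tape 4 records how the number on tape 1 compares with the one on tape 0:
   [bitg true] for less, [bitg false] for greater, and a blank for equal. *)
Definition compare : prog :=
  While (fun g => is_bit (nth None g 0) || is_bit (nth None g 1))
    (Do (fun g =>
      let x := nth None g 0 in let y := nth None g 1 in
      [:: step_if_bit x; step_if_bit y; None; None;
          Some (if bit_of x == bit_of y then nth None g 4 else bitg (bit_of x),
                Stay)])).

(** The low bits are read first, so a later difference overrides an earlier one: [f] is the outcome
    on the bits already passed, and it survives only if the remaining words have equal values. *)
Definition verdict (f : glyph) (x y : seq bool) : glyph :=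
  if bval x == bval y then f else bitg (bval y < bval x).

Lemma verdict_step f x y :
  verdict (if head false x == head false y then f else bitg (head false x))
    (behead x) (behead y) = verdict f x y.
Proof.
have bvalE w : bval w = head false w + (bval (behead w)).*2 by case: w.
rewrite /verdict (bvalE x) (bvalE y).
move: (bval (behead x)) (bval (behead y)) => m n.
case: (head false x); case: (head false y) => /=; rewrite ?add0n ?eqxx.
all: case: (ltngtP m n) => mn.
all: case: eqP => [?|?]; try lia; try done; congr bitg; lia.
Qed.

Lemma exec_compare x y f l0 t0 r0 l1 t1 r1 T2 T3 T5 :
  ~~ is_bit t0 -> ~~ is_bit t1 ->
  exec compare (2 * (size x + size y)).+1
    [:: trk l0 (map bitg x ++ t0 :: r0); trk l1 (map bitg y ++ t1 :: r1);
        T2; T3; trk [::] [:: f]; T5]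
    [:: trk (rev (map bitg x) ++ l0) (t0 :: r0);
        trk (rev (map bitg y) ++ l1) (t1 :: r1); T2; T3;
        trk [::] [:: verdict f x y]; T5].
Proof.
move=> Ht0 Ht1.
have bit0 : bit_of t0 = false by case: (t0) Ht0 => [[[]|]|].
have bit1 : bit_of t1 = false by case: (t1) Ht1 => [[[]|]|].
have [n] := ubnP (size x + size y).
elim: n x y f l0 l1 => // n IH [|a x] [|b y] f l0 l1 le_n.
- by apply: exec_while_stop; rewrite /= !scan_trk /= negb_or Ht0.
all: rewrite -verdict_step /= ?rev_consE; rewrite /= in le_n.
- apply: exec_le (exec_while_loop _ _ (IH [::] y _ l0 (bitg b :: l1) _)) _.
  + by rewrite /= !scan_trk orbT.
  + by apply: exec_do; rewrite /= !scan_trk /= !trkE /= (negPf Ht0) bit0 trkE.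
  + by rewrite /=; lia.
  + by rewrite /=; lia.
- apply: exec_le (exec_while_loop _ _ (IH x [::] _ (bitg a :: l0) l1 _)) _.
  + by [].
  + by apply: exec_do; rewrite /= !scan_trk /= !trkE /= (negPf Ht1) bit1 trkE.
  + by rewrite /=; lia.
  + by rewrite /=; lia.
- apply: exec_le (exec_while_loop _ _
    (IH x y _ (bitg a :: l0) (bitg b :: l1) _)) _.
  + by [].
  + by apply: exec_do; rewrite /= !scan_trk /= !trkE.
  + by rewrite /=; lia.
  + by rewrite /=; lia.
Qed.

Definition carry_over : prog :=
  While (fun g => bit_of (nth None g 2)) (put 2 (bitg false) ShiftRight).

(** [u] is the initial run of ones, turned into zeros, and [v] is the rest, whose first bit is 0 or
    missing. The 1 still to be written replaces that bit, or extends the number if [v] is empty. *)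
Lemma exec_carry_over x l T0 T1 T3 T4 T5 : trimmed x ->
  exists u v,
    [/\ trimmed (u ++ true :: behead v),
        bval (u ++ true :: behead v) = (bval x).+1, size u <= size x &
      exec carry_over (2 * size x).+1
        [:: T0; T1; trk l (map bitg x); T3; T4; T5]
        [:: T0; T1; trk (rev (map bitg u) ++ l) (map bitg v); T3; T4; T5]].
Proof.
elim: x l => [|a x IH] l Cx.
  by exists [::], [::]; split=> //; apply: exec_while_stop.
case: a Cx; last first.
  exists [::], (false :: x); split=> //; last first.
    by apply: exec_le (exec_while_stop _ _) _.
  by move: Cx; rewrite !trimmed_cons => /andP[_ ->]; rewrite implybT.
rewrite trimmed_cons => /andP[_ /(IH (bitg false :: l))].
case=> u [v [Cuv Euv le_u Hx]]; exists (false :: u), v; split=> //.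
- by rewrite cat_cons trimmed_cons Cuv; case: (u).
- by rewrite /= Euv; lia.
- rewrite /= rev_consE; apply: exec_le (exec_while_loop _ _ Hx) _ => //.
    by apply: exec_do; rewrite /= trkE.
  by rewrite /=; lia.
Qed.

Definition increment : prog :=
  Seq carry_over (Seq (put 2 (bitg true) Stay) (rewind 2 is_blank)).

Lemma exec_increment n T0 T1 T3 T4 T5 :
  exec increment (4 * size (bits_of_nat n) + 5)
    [:: T0; T1; trk [::] (num n); T3; T4; T5]
    [:: T0; T1; trk [::] (num n.+1); T3; T4; T5].
Proof.
have [u [v [Cuv Euv le_u Hc]]] :=
  exec_carry_over [::] T0 T1 T3 T4 T5 (trimmed_bits n).
rewrite bval_bits in Euv.
have -> : num n.+1 = map bitg u ++ bitg true :: behead (map bitg v).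
  by rewrite /num -Euv -bits_bval // map_cat; case: (v).
apply: exec_le (exec_seq Hc (exec_seq (exec_put [:: T0; T1] _ _ _ _) _)) _.
  rewrite trkE; apply: (exec_rewind (p := is_blank) [:: T0; T1]) => //.
  by rewrite all_map; apply/allP.
by rewrite size_map; lia.
Qed.

(** The sum overwrites the summand on tape 3 bit by bit. The carry on tape 4 is a comma or a blank,
    and the loop goes on while a carry is pending, even after both numbers have ended. *)
Definition adder : prog :=
  While (fun g => [|| is_bit (nth None g 1), is_bit (nth None g 3)
                    | is_comma (nth None g 4)])
    (Do (fun g =>
      let a := bit_of (nth None g 1) in let b := bit_of (nth None g 3) in
      let c := is_comma (nth None g 4) in
      [:: None; step_if_bit (nth None g 1); None;
          Some (bitg (a (+) b (+) c), ShiftRight);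
          Some (if a + b + c >= 2 then commag else None, Stay)])).

Lemma exec_add x y (c : bool) l1 t r l3 T0 T2 T5 :
  trimmed x -> trimmed y -> ~~ is_bit t ->
  exists w, [/\ trimmed w, bval w = bval x + bval y + c,
                size w <= size x + size y + c &
    exec adder (2 * (size x + size y + c)).+1
      [:: T0; trk l1 (map bitg x ++ t :: r); T2; trk l3 (map bitg y);
          trk [::] [:: if c then commag else None]; T5]
      [:: T0; trk (rev (map bitg x) ++ l1) (t :: r); T2;
          trk (rev (map bitg w) ++ l3) [::]; trk [::] [::]; T5]].
Proof.
move=> Cx Cy Ht; have bit0 : bit_of t = false by case: (t) Ht => [[[]|]|].
have [n] := ubnP (size x + size y + c).
elim: n x y c l1 l3 Cx Cy => // n IH x y c l1 l3 Cx Cy le_n.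
have [d Ed] : exists d : bool, d = (2 <= head false x + head false y + c).
  by eexists.
have [E0|N0] := eqVneq (size x + size y + c) 0.
  have [Ex Ey Ec] : [/\ x = [::], y = [::] & c = false].
    by case: (x) E0; case: (y); case: (c).
  exists [::]; split; rewrite ?Ex ?Ey ?Ec // -(trk_blank1 [::]).
  by apply: exec_while_stop; rewrite /= !scan_trk /= orbF.
have Cb w : trimmed w -> trimmed (behead w).
  by case: w => // a w; rewrite trimmed_cons => /andP[].
have bvalE w : bval w = head false w + (bval (behead w)).*2 by case: w.
(* A carry out needs at least two ones among the two bits and the carry in, all of which are
   consumed; hence the measure drops. *)
have le_d : size (behead x) + size (behead y) + d < size x + size y + c.
  move: N0; rewrite Ed; clear.
  by case: x => [|[] ?]; case: y => [|[] ?]; case: c => /=; lia.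
pose l1' := if x is a :: _ then bitg a :: l1 else l1.
pose b := head false x (+) head false y (+) c.
have [|w [Cw Ew le_w Hw]] :=
  IH _ _ d l1' (bitg b :: l3) (Cb _ Cx) (Cb _ Cy).
  exact: leq_trans le_d le_n.
have Ebw : bval (b :: w) = bval x + bval y + c.
  rewrite /= Ew (bvalE x) (bvalE y) /b Ed; clear.
  by case: (head false x); case: (head false y); case: c => /=; lia.
exists (b :: w); split=> //=; last 1 first.
- rewrite rev_consE.
  have -> : rev (map bitg x) ++ l1 = rev (map bitg (behead x)) ++ l1'.
    by rewrite /l1'; case: (x) => //= a x'; rewrite rev_consE.
  pose k := 2 * (size (behead x) + size (behead y) + d).
  apply: (@exec_le _ (1 + k.+1).+1); last by move: le_d; rewrite /k; clear; lia.
  apply: exec_while_loop Hw.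
    rewrite /= !scan_trk; case: (x) N0 => [|a ?] //.
    by case: (y) => [|a ?]; case: (c); rewrite /= ?orbT.
  apply: exec_do; rewrite /= !scan_trk.
  have -> : is_comma (if c then commag else None) = c by case: (c).
  have -> : bit_of (head None (map bitg x ++ t :: r)) = head false x.
    by case: (x).
  have -> : bit_of (head None (map bitg y)) = head false y by case: (y).
  rewrite -/b -Ed !trkE behead_map /l1'.
  by case: (x) => [|a x'] /=; rewrite ?(negPf Ht) !trkE.
(* If the last bit written were 0, the whole sum would be 0; then both trimmed words would be empty
   and the carry absent, and the loop would not have been entered. *)
- rewrite trimmed_cons Cw andbT; apply/implyP => /eqP Ew0.
  move: Ebw; rewrite Ew0 /= addn0; case: (b) => // Exy.
  suff : size x + size y + c = 0 by move/eqP; rewrite (negPf N0).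
  move/esym/eqP: Exy; rewrite !addn_eq0 =>
    /andP[/andP[/eqP Ex /eqP Ey] /eqP Ec].
  by rewrite (bval_eq0 Cx Ex) (bval_eq0 Cy Ey) Ec.
- exact: leq_ltn_trans le_w le_d.
Qed.

(* Moves the number on tape [i] to the end of tape [i + k.+1]. *)
Definition output (i k : nat) : prog :=
  Seq (While (fun g => is_bit (nth None g i))
         (Do (fun g => ncons i None (Some (None, ShiftRight)
            :: ncons k None [:: Some (nth None g i, ShiftRight)]))))
    (put (i + k.+1) commag ShiftRight).

(** The number is erased as it is copied. What remains is a run of blanks to the left of the head,
    which is the empty tape: the counter is reset to 0 without any rewinding. *)
Lemma exec_output n s1 s2 o :
  exec (output (size s1) (size s2)) (2 * size (bits_of_nat n) + 2)
    (s1 ++ trk [::] (num n) :: s2 ++ [:: trk o [::]])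
    (s1 ++ trk [::] [::] :: s2
        ++ [:: trk (rev (glyphs (Defs.number n)) ++ o) [::]]).
Proof.
set w := bits_of_nat n.
have -> : rev (glyphs (Defs.number n)) ++ o = commag :: rev (map bitg w) ++ o.
  by rewrite /Defs.number /field /glyphs map_rcons rev_rcons -map_comp.
have -> : 2 * size w + 2 = (2 * size w).+1 + 1 by lia.
apply: (@exec_seq _ _ _ _ _
  (s1 ++ trk (nseq (size w) None) [::] :: s2
      ++ [:: trk (rev (map bitg w) ++ o) [::]])); last first.
  have := exec_put (s1 ++ trk [::] [::] :: s2)
    (trk (rev (map bitg w) ++ o) [::]) [::] commag ShiftRight.
  by rewrite trkE size_cat /= -!catA trk_blankl.
rewrite /num -/w.
suff H m l : exec (While (fun g => is_bit (nth None g (size s1)))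
      (Do (fun g => ncons (size s1) None (Some (None, ShiftRight)
         :: ncons (size s2) None
              [:: Some (nth None g (size s1), ShiftRight)]))))
    (2 * size w).+1
    (s1 ++ trk (nseq m None) (map bitg w) :: s2 ++ [:: trk l [::]])
    (s1 ++ trk (nseq (m + size w) None) [::]
        :: s2 ++ [:: trk (rev (map bitg w) ++ l) [::]]).
  exact: (H 0 o).
elim: {n o}w m l => [|a w IH] m l.
  by rewrite addn0; apply: exec_while_stop; rewrite nth_scan scan_trk.
rewrite /= rev_consE -addSnnS.
have -> : (2 * (size w).+1).+1 = (1 + (2 * size w).+1).+1 by lia.
apply: exec_while_loop (IH _ _).
  by rewrite nth_scan scan_trk.
apply: exec_do; rewrite nth_scan scan_trk /=.
clear IH; elim: s1 => [|t s1 IH1] /=; last by rewrite IH1.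
rewrite !trkE /=; congr cons; rewrite perform_at.
by rewrite trkE.
Qed.

(** * Ranking the costs *)

(* A cost is listed on tape 1 together with a mark, which is stored in its
   separator: a semicolon if it is marked, a comma otherwise. *)
Definition separator (m : bool) : glyph := if m then semig else commag.

Definition entry_code (it : nat * bool) : seq glyph :=
  rcons (num it.1) (separator it.2).

Definition list_code (its : seq (nat * bool)) : seq glyph :=
  flatten (map entry_code its).

(* Ties are broken by position: when [c] is examined, the marked entries are
   [c] itself and those before it. *)
Definition precedes (c : nat) (it : nat * bool) : bool :=
  (it.1 < c) || (it.1 == c) && it.2.

(** Tape 4 still holds the verdict of [compare]; clearing it starts [adder] with no carry. *)
Definition count_entry : prog :=
  Seq (rewind 1 (predC is_bit))
    (Seq increment
      (Seq (put 4 None Stay) (Seq adder (rewind 3 is_blank)))).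

(** After [compare], the head of tape 1 stands on the separator of the entry, so the mark that
    breaks a tie is under the head when the verdict is a blank. *)
Definition examine : prog :=
  Seq compare
    (Seq (rewind 0 (predC is_bit))
      (Seq (If (fun g => let f := nth None g 4 in
                  is_bit f && bit_of f || is_blank f && is_semi (nth None g 1))
              count_entry (put 4 None Stay))
        (move 1 ShiftRight))).

Lemma all_num (p : pred glyph) n : (forall b, p (bitg b)) -> all p (num n).
Proof. by move=> p_bit; rewrite all_map; apply/allP => b _ /=. Qed.

Lemma size_num n : size (num n) = size (bits_of_nat n).
Proof. exact: size_map. Qed.

Lemma exec_count_entry B c k v l1 t r1 T0 f T5 :
  k.+1 < 2 ^ B -> v + c < 2 ^ B -> ~~ is_bit (head None l1) -> ~~ is_bit t ->
  exec count_entry (20 * B + 20)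
    [:: T0; trk (rev (num c) ++ l1) (t :: r1); trk [::] (num k);
        trk [::] (num v); trk [::] [:: f]; T5]
    [:: T0; trk (rev (num c) ++ l1) (t :: r1); trk [::] (num k.+1);
        trk [::] (num (v + c)); trk [::] [::]; T5].
Proof.
move=> /ltnW/size_bits le_k lt_vc Hl1 Ht.
have le_v : size (bits_of_nat v) <= B by apply: size_bits; lia.
have le_c : size (bits_of_nat c) <= B by apply: size_bits; lia.
have [w [Cw Ew _ Hadd]] := exec_add false l1 r1 [::] T0
  (trk [::] (num k.+1)) T5 (trimmed_bits c) (trimmed_bits v) Ht.
have {}Ew : map bitg w = num (v + c).
  by rewrite /num (bits_bval Cw) Ew !bval_bits addn0 addnC.
rewrite Ew cats0 addn0 in Hadd.
have Hrw1 := @exec_rewind (predC is_bit) (num c) [:: T0] l1 (t :: r1)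
  [:: trk [::] (num k); trk [::] (num v); trk [::] [:: f]; T5]
  (all_num _ (fun b => isT)) Hl1.
have Hinc := exec_increment k T0 (trk l1 (num c ++ t :: r1))
  (trk [::] (num v)) (trk [::] [:: f]) T5.
have Hput := exec_put [:: T0; trk l1 (num c ++ t :: r1);
  trk [::] (num k.+1); trk [::] (num v)] (trk [::] [:: f]) [:: T5] None Stay.
rewrite trkE in Hput.
have Hrw3 := @exec_rewind is_blank (num (v + c))
  [:: T0; trk (rev (num c) ++ l1) (t :: r1); trk [::] (num k.+1)] [::] [::]
  [:: trk [::] [::]; T5] (all_num _ (fun b => isT)) isT.
rewrite !cats0 in Hrw3.
apply: exec_le (exec_seq Hrw1 (exec_seq Hinc (exec_seq Hput
  (exec_seq Hadd Hrw3)))) _.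
have := size_bits lt_vc.
by rewrite !size_num; lia.
Qed.

Lemma exec_examine B c it k v l0 r0 l1 r1 T5 :
  c < 2 ^ B -> k.+1 < 2 ^ B -> v + it.1 < 2 ^ B ->
  ~~ is_bit (head None l0) -> ~~ is_bit (head None l1) ->
  exec examine (30 * B + 30)
    [:: trk l0 (num c ++ commag :: r0); trk l1 (entry_code it ++ r1);
        trk [::] (num k); trk [::] (num v); trk [::] [::]; T5]
    [:: trk l0 (num c ++ commag :: r0); trk (rev (entry_code it) ++ l1) r1;
        trk [::] (num (k + precedes c it));
        trk [::] (num (v + precedes c it * it.1)); trk [::] [::]; T5].
Proof.
case: it => c' m /= lt_c lt_k lt_vc' Hl0 Hl1.
have le_c := size_bits lt_c.
have le_c' : size (bits_of_nat c') <= B by apply: size_bits; lia.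
rewrite rev_rcons cat_rcons /=.
have Hsep : ~~ is_bit (separator m) by case: m.
have Hcmp := @exec_compare (bits_of_nat c) (bits_of_nat c') None l0 commag r0
  l1 (separator m) r1 (trk [::] (num k)) (trk [::] (num v)) T5 isT Hsep.
rewrite -/(num c) -/(num c') trk_blank1 /verdict !bval_bits in Hcmp.
set f := (if _ then _ else _) in Hcmp.
have Hrw := @exec_rewind (predC is_bit) (num c) [::] l0 (commag :: r0)
  [:: trk (rev (num c') ++ l1) (separator m :: r1); trk [::] (num k);
      trk [::] (num v); trk [::] [:: f]; T5] (all_num _ (fun b => isT)) Hl0.
pose s k v := [:: trk l0 (num c ++ commag :: r0);
  trk (rev (num c') ++ l1) (separator m :: r1); trk [::] (num k);
  trk [::] (num v); trk [::] [::]; T5].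
pose b := precedes c (c', m).
have Hif : exec (If (fun g => let f := nth None g 4 in
                  is_bit f && bit_of f || is_blank f && is_semi (nth None g 1))
              count_entry (put 4 None Stay)) (20 * B + 21)
    [:: trk l0 (num c ++ commag :: r0);
        trk (rev (num c') ++ l1) (separator m :: r1); trk [::] (num k);
        trk [::] (num v); trk [::] [:: f]; T5] (s (k + b) (v + b * c')).
  rewrite addnS; apply: exec_if; rewrite /= !scan_trk /=.
  have -> : is_bit f && bit_of f || is_blank f && is_semi (separator m) = b.
    rewrite /f /b /precedes /= [c == c']eq_sym.
    by case: ltngtP => //= _; case: (m).
  case: b; rewrite ?mul1n ?mul0n ?addn0 ?addn1.
    exact: exec_count_entry.
  have := exec_put [:: trk l0 (num c ++ commag :: r0);
    trk (rev (num c') ++ l1) (separator m :: r1); trk [::] (num k);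
    trk [::] (num v)] (trk [::] [:: f]) [:: T5] None Stay.
  by rewrite trkE trk_blank1 => /exec_le; apply; lia.
have := exec_move [:: trk l0 (num c ++ commag :: r0)]
  (trk (rev (num c') ++ l1) (separator m :: r1))
  [:: trk [::] (num (k + b)); trk [::] (num (v + b * c')); trk [::] [::]; T5]
  ShiftRight.
rewrite scan_trk trkE => Hmove.
apply: exec_le (exec_seq Hcmp (exec_seq Hrw (exec_seq Hif Hmove))) _.
by rewrite !size_num; lia.
Qed.

Definition examine_all : prog :=
  While (fun g => ~~ is_blank (nth None g 1)) examine.

Definition rank_upto (c : nat) (its : seq (nat * bool)) : nat :=
  count (precedes c) its.

Definition sum_upto (c : nat) (its : seq (nat * bool)) : nat :=
  \sum_(it <- its | precedes c it) it.1.

(** The bounds on [k + size its] and on [v] plus the total cost are invariant along the list. They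
    dominate every intermediate count and sum, so each entry takes time linear in [B]. *)
Lemma exec_examine_all B c its k v l0 r0 l1 T5 :
  c < 2 ^ B -> k + size its < 2 ^ B -> v + \sum_(it <- its) it.1 < 2 ^ B ->
  ~~ is_bit (head None l0) -> ~~ is_bit (head None l1) ->
  exec examine_all (size its * (30 * B + 31)).+1
    [:: trk l0 (num c ++ commag :: r0); trk l1 (list_code its);
        trk [::] (num k); trk [::] (num v); trk [::] [::]; T5]
    [:: trk l0 (num c ++ commag :: r0); trk (rev (list_code its) ++ l1) [::];
        trk [::] (num (k + rank_upto c its));
        trk [::] (num (v + sum_upto c its));
        trk [::] [::]; T5].
Proof.
move=> lt_c + + Hl0; rewrite /sum_upto.
elim: its k v l1 => [|it its IH] k v l1 lt_k lt_v Hl1.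
  by rewrite big_nil !addn0; apply: exec_while_stop.
rewrite /= in lt_k; rewrite big_cons in lt_v.
have -> : v + \sum_(jt <- it :: its | precedes c jt) jt.1
    = v + precedes c it * it.1 + \sum_(jt <- its | precedes c jt) jt.1.
  by rewrite big_cons; case: precedes; rewrite ?mul1n ?mul0n ?addn0 ?addnA.
rewrite /rank_upto /= addnA /list_code /= rev_cat -catA -/(rank_upto c its).
have le_b : precedes c it <= 1 by case: precedes.
have {}IH := IH (k + precedes c it) (v + precedes c it * it.1)
  (rev (entry_code it) ++ l1).
have Hex := @exec_examine B c it k v l0 r0 l1 (list_code its) T5 lt_c.
apply: exec_le (exec_while_loop _ (Hex _ _ Hl0 Hl1) (IH _ _ _)) _.
- rewrite /= !scan_trk /= /entry_code.
  by case: (num it.1) (all_num (p := predC is_blank) it.1 (fun=> isT))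
    => [|a w] /=;
    [case: it.2 | case/andP].
- by move: lt_k; clear; lia.
- by move: lt_v; clear; lia.
- by move: lt_k le_b; clear; lia.
- by move: lt_v; clear; case: precedes; rewrite ?mul1n ?mul0n; lia.
- by rewrite /entry_code rev_rcons; case: it.2.
- by rewrite mulSn; clear; lia.
Qed.

(** The marked entries form a prefix of the list, so the first comma is the separator of the next
    cost to be ranked. *)
Definition mark_next : prog :=
  Seq (advance 1 (predC is_comma)) (Seq (put 1 semig Stay) (rewind 1 is_blank)).

Definition marked : seq nat -> seq (nat * bool) := map (fun c => (c, true)).
Definition unmarked : seq nat -> seq (nat * bool) := map (fun c => (c, false)).

Lemma all_list_code (p : pred glyph) its :
  (forall b, p (bitg b)) -> all (fun it => p (separator it.2)) its ->
  all p (list_code its).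
Proof.
move=> p_bit; elim: its => //= it its IH /andP[p_sep /IH{}IH].
by rewrite all_cat IH all_rcons p_sep all_num.
Qed.

Lemma list_code_cat its1 its2 :
  list_code (its1 ++ its2) = list_code its1 ++ list_code its2.
Proof. by rewrite /list_code map_cat flatten_cat. Qed.

Lemma exec_mark_next pre c suf T0 T2 T3 T4 T5 :
  let L := list_code (marked (rcons pre c) ++ unmarked suf) in
  exec mark_next (4 * size L + 10)
    [:: T0; trk [::] (list_code (marked pre ++ unmarked (c :: suf))); T2; T3;
        T4; T5]
    [:: T0; trk [::] L; T2; T3; T4; T5].
Proof.
set w := list_code (marked pre) ++ num c; set r := list_code (unmarked suf).
have EL : list_code (marked (rcons pre c) ++ unmarked suf) = w ++ semig :: r.
  rewrite list_code_cat /marked map_rcons -cats1 list_code_cat.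
  by rewrite /w /list_code /= /entry_code cats0 -!catA cat_rcons.
have -> : list_code (marked pre ++ unmarked (c :: suf)) = w ++ commag :: r.
  by rewrite list_code_cat /w /list_code /= /entry_code -!catA cat_rcons.
rewrite {}EL /=.
have Hadv := @exec_advance (predC is_comma) w [:: T0] [::] (commag :: r)
  [:: T2; T3; T4; T5].
have Hput := exec_put [:: T0] (trk (rev w) (commag :: r)) [:: T2; T3; T4; T5]
  semig Stay.
have Hrw := @exec_rewind is_blank w [:: T0] [::] (semig :: r)
  [:: T2; T3; T4; T5].
rewrite trkE in Hput; rewrite !cats0 in Hadv Hrw.
apply: exec_le (exec_seq (Hadv _ _) (exec_seq Hput (Hrw _ _))) _ => //.
- by rewrite all_cat all_num ?andbT // all_list_code // all_map; apply/allP.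
- by rewrite all_cat all_num ?andbT // all_list_code // all_map; apply/allP.
- by rewrite size_cat /=; move: (size w) (size r); clear; lia.
Qed.

Lemma size_list_code its :
  size (list_code its) = \sum_(it <- its) (size (num it.1)).+1.
Proof.
elim: its => [|it its IH]; first by rewrite big_nil.
by rewrite big_cons -IH /list_code /= size_cat size_rcons.
Qed.

(** A mark replaces one separator by another, so a single bound [B] serves for all rounds. *)
Lemma size_list_code_marks pre suf :
  size (list_code (marked pre ++ unmarked suf))
    = size (list_code (unmarked (pre ++ suf))).
Proof. by rewrite !size_list_code /unmarked map_cat !big_cat !big_map. Qed.

Lemma size_le_list_code its : size its <= size (list_code its).
Proof.
rewrite size_list_code -sum1_size; exact: leq_sum.
Qed.

(** If [n < 2 ^ b] and [s < p], then [n + s < 2 * 2 ^ b * p]; the extra factor 2 is paid for by the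
    separator of the entry. *)
Lemma sum_lt_list_code its : \sum_(it <- its) it.1 < 2 ^ size (list_code its).
Proof.
rewrite size_list_code; elim: its => [|it its]; rewrite ?big_nil // !big_cons.
rewrite addSn expnS expnD size_num; set p := 2 ^ \sum_(_ <- _) _.
have := bval_lt (bits_of_nat it.1); rewrite bval_bits; nia.
Qed.

(** * The rounds and the complete machine *)

Definition process : prog :=
  Seq mark_next (Seq examine_all (Seq (rewind 1 is_blank)
    (Seq (output 2 2) (Seq (output 3 1)
      (Seq (advance 0 is_bit) (move 0 ShiftRight)))))).

Lemma exec_process B pre c suf l0 r0 o :
  let its := marked (rcons pre c) ++ unmarked suf in
  size (list_code its) <= B -> ~~ is_bit (head None l0) ->
  exec process (100 * B.+1 ^ 2)
    [:: trk l0 (num c ++ commag :: r0);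
        trk [::] (list_code (marked pre ++ unmarked (c :: suf)));
        trk [::] [::]; trk [::] [::]; trk [::] [::]; trk o [::]]
    [:: trk (commag :: rev (num c) ++ l0) r0; trk [::] (list_code its);
        trk [::] [::]; trk [::] [::]; trk [::] [::];
        trk (rev (glyphs
          (encode_points [:: (rank_upto c its, sum_upto c its)])) ++ o)
          [::]].
Proof.
move=> its le_B Hl0.
have le_its : size its <= B := leq_trans (size_le_list_code its) le_B.
have lt_B : B < 2 ^ B by apply: ltn_expl.
have lt_sum : \sum_(it <- its) it.1 < 2 ^ B.
  by apply: leq_trans (sum_lt_list_code its) _; rewrite leq_exp2l.
have lt_c : c < 2 ^ B.
  apply: leq_ltn_trans lt_sum; rewrite /its /marked map_rcons -cats1 -catA.
  by rewrite big_cat big_cons /= addnCA leq_addr.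
have lt_tot : sum_upto c its < 2 ^ B.
  by apply: leq_ltn_trans lt_sum; rewrite /sum_upto; elim: (its) => [|it s IH];
    rewrite ?big_nil // !big_cons; case: ifP; lia.
have lt_rank : rank_upto c its < 2 ^ B.
  by rewrite (leq_ltn_trans _ lt_B) // (leq_trans _ le_its) // count_size.
have Hmark := exec_mark_next pre c suf (trk l0 (num c ++ commag :: r0))
  (trk [::] [::]) (trk [::] [::]) (trk [::] [::]) (trk o [::]).
have Hex := @exec_examine_all B c its 0 0 l0 r0 [::] (trk o [::]) lt_c
  (leq_ltn_trans le_its lt_B) lt_sum Hl0 isT.
rewrite !add0n in Hex.
have Hrw := @exec_rewind is_blank (list_code its)
  [:: trk l0 (num c ++ commag :: r0)] [::] [::]
  [:: trk [::] (num (rank_upto c its)); trk [::] (num (sum_upto c its));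
      trk [::] [::]; trk o [::]].
rewrite !cats0 in Hrw; rewrite cats0 in Hex.
have Hout2 := exec_output (rank_upto c its)
  [:: trk l0 (num c ++ commag :: r0); trk [::] (list_code its)]
  [:: trk [::] (num (sum_upto c its)); trk [::] [::]] o.
have Hout3 := exec_output (sum_upto c its)
  [:: trk l0 (num c ++ commag :: r0); trk [::] (list_code its); trk [::] [::]]
  [:: trk [::] [::]] (rev (glyphs (Defs.number (rank_upto c its))) ++ o).
set o' := rev _ ++ _ ++ o in Hout3.
have -> : rev (glyphs (encode_points [:: (rank_upto c its, sum_upto c its)]))
    ++ o = o'.
  by rewrite /encode_points /= cats0 /glyphs map_cat rev_cat -catA.
have Hadv := @exec_advance is_bit (num c) [::] l0 (commag :: r0)
  [:: trk [::] (list_code its); trk [::] [::]; trk [::] [::]; trk [::] [::];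
      trk o' [::]] (all_num _ (fun b => isT)) isT.
have Hmove := exec_move [::] (trk (rev (num c) ++ l0) (commag :: r0))
  [:: trk [::] (list_code its); trk [::] [::]; trk [::] [::]; trk [::] [::];
      trk o' [::]] ShiftRight.
rewrite scan_trk trkE in Hmove.
apply: exec_le (exec_seq Hmark (exec_seq Hex (exec_seq (Hrw _ isT)
  (exec_seq Hout2 (exec_seq Hout3 (exec_seq Hadv Hmove)))))) _.
  apply: all_list_code => //; rewrite /its all_cat !all_map.
  by apply/andP; split; apply/allP.
have := size_bits lt_c; have := size_bits lt_tot; have := size_bits lt_rank.
have : size its * (30 * B + 31) <= B * (30 * B + 31).
  by rewrite leq_mul2r le_its orbT.
have -> : B.+1 ^ 2 = B * B + 2 * B + 1 by rewrite expnS expn1; clear; lia.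
rewrite size_num -/its; move: le_B; clear.
move: (size (list_code its)) (size its * (30 * B + 31)) (size (bits_of_nat c)).
move: (size (bits_of_nat (rank_upto c its))).
by move: (size (bits_of_nat (sum_upto c its))); lia.
Qed.

Fixpoint points (pre suf : seq nat) : seq (nat * nat) :=
  if suf is c :: suf' then
    let its := marked (rcons pre c) ++ unmarked suf' in
    (rank_upto c its, sum_upto c its) :: points (rcons pre c) suf'
  else [::].

Definition process_all : prog :=
  While (fun g => ~~ is_semi (nth None g 0)) process.

Lemma exec_process_all B pre suf l0 r0 o :
  size (list_code (unmarked (pre ++ suf))) <= B -> ~~ is_bit (head None l0) ->
  exists T0 T1, exec process_all (size suf * (100 * B.+1 ^ 2).+1).+1
    [:: trk l0 (list_code (unmarked suf) ++ semig :: r0);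
        trk [::] (list_code (marked pre ++ unmarked suf));
        trk [::] [::]; trk [::] [::]; trk [::] [::]; trk o [::]]
    [:: T0; T1; trk [::] [::]; trk [::] [::]; trk [::] [::];
        trk (rev (glyphs (encode_points (points pre suf))) ++ o) [::]].
Proof.
elim: suf pre l0 o => [|c suf IH] pre l0 o le_B Hl0.
  by do 2 eexists; apply: exec_while_stop.
rewrite -cat_rcons in le_B; pose its := marked (rcons pre c) ++ unmarked suf.
pose p := (rank_upto c its, sum_upto c its).
have [T0 [T1 Hrec]] := IH (rcons pre c) (commag :: rev (num c) ++ l0)
  (rev (glyphs (encode_points [:: p])) ++ o) le_B isT.
exists T0, T1.
have -> : rev (glyphs (encode_points (points pre (c :: suf)))) ++ o
    = rev (glyphs (encode_points (points (rcons pre c) suf)))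
      ++ rev (glyphs (encode_points [:: p])) ++ o.
  rewrite catA -rev_cat /glyphs -map_cat; congr (rev (map _ _) ++ _).
  by rewrite /encode_points /= cats0.
have -> : list_code (unmarked (c :: suf)) ++ semig :: r0
    = num c ++ commag :: list_code (unmarked suf) ++ semig :: r0.
  by rewrite /list_code /= /entry_code -catA cat_rcons.
have le_its : size (list_code its) <= B by rewrite size_list_code_marks.
have Hp := exec_process (list_code (unmarked suf) ++ semig :: r0) o le_its Hl0.
apply: exec_le (exec_while_loop _ Hp Hrec) _; last by rewrite /=; clear; lia.
rewrite /= scan_trk.
by case: (num c) (all_num (p := predC is_semi) c (fun b => isT)) =>
  //= a w /andP[].
Qed.

Definition copy : prog :=
  While (fun g => ~~ is_semi (nth None g 0))
    (Do (fun g => let c := Some (nth None g 0, ShiftRight) in [:: c; c])).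

Lemma exec_copy w l0 r0 l1 s : all (predC is_semi) w ->
  exec copy (2 * size w).+1
    [:: trk l0 (w ++ semig :: r0), trk l1 [::] & s]
    [:: trk (rev w ++ l0) (semig :: r0), trk (rev w ++ l1) [::] & s].
Proof.
elim: w l0 l1 => [|c w IH] l0 l1 /=.
  by move=> _; apply: exec_while_stop.
case/andP=> Hc Hw; rewrite !rev_consE.
apply: exec_le (exec_while_loop _ _ (IH _ _ Hw)) _.
- by rewrite /= scan_trk.
- by apply: exec_do; rewrite /= !scan_trk !trkE.
- by rewrite /=; clear; lia.
Qed.

(** No cost has rank 0. The two commas written beforehand on tape 5 are the code of the missing
    point [(0, 0)], that of the empty set. *)
Definition solver : prog :=
  Seq (advance 0 (predC is_semi))
  (Seq (move 0 ShiftRight)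
  (Seq copy
  (Seq (rewind 0 is_semi)
  (Seq (rewind 1 is_blank)
  (Seq (put 5 commag ShiftRight)
  (Seq (put 5 commag ShiftRight) process_all)))))).

Lemma exec_solver n cs r0 :
  let w := num n ++ commag :: semig :: list_code (unmarked cs) ++ semig :: r0 in
  exists T0 T1, exec solver (200 * (size w).+1 ^ 3)
    [:: trk [::] w; trk [::] [::]; trk [::] [::]; trk [::] [::]; trk [::] [::];
        trk [::] [::]]
    [:: T0; T1; trk [::] [::]; trk [::] [::]; trk [::] [::];
        trk (rev (glyphs (encode_points ((0, 0) :: points [::] cs)))) [::]].
Proof.
set L := list_code (unmarked cs); set l0 := rev (rcons (num n) commag) => w.
have Ew : w = rcons (num n) commag ++ semig :: L ++ semig :: r0.
  by rewrite cat_rcons.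
have L_code (p : pred glyph) : (forall b, p (bitg b)) -> p commag -> all p L.
  by move=> p_bit p_comma; apply: all_list_code => //; rewrite all_map;
     apply/allP.
have Hskip := @exec_advance (predC is_semi) (rcons (num n) commag) [::] [::]
  (semig :: L ++ semig :: r0) (nseq 5 (trk [::] [::])).
have Hmove := exec_move [::] (trk l0 (semig :: L ++ semig :: r0))
  (nseq 5 (trk [::] [::])) ShiftRight.
have Hcopy := @exec_copy L (semig :: l0) r0 [::] (nseq 4 (trk [::] [::])).
have Hrw0 := @exec_rewind is_semi L [::] (semig :: l0) (semig :: r0)
  (trk (rev L) [::] :: nseq 4 (trk [::] [::])).
have Hrw1 := @exec_rewind is_blank L
  [:: trk (semig :: l0) (L ++ semig :: r0)] [::] [::] (nseq 4 (trk [::] [::])).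
have Hput1 := exec_put [:: trk (semig :: l0) (L ++ semig :: r0); trk [::] L;
  trk [::] [::]; trk [::] [::]; trk [::] [::]] (trk [::] [::])
    [::] commag ShiftRight.
have Hput2 := exec_put [:: trk (semig :: l0) (L ++ semig :: r0); trk [::] L;
  trk [::] [::]; trk [::] [::]; trk [::] [::]] (trk [:: commag] [::]) [::]
  commag ShiftRight.
rewrite /= !trkE ?scan_trk /= in Hmove Hput1 Hput2.
rewrite !cats0 in Hskip Hcopy Hrw1.
have [|T0 [T1 Hall]] := @exec_process_all (size L) [::] cs (semig :: l0) r0
  [:: commag; commag] _ isT; first exact: leqnn.
exists T0, T1.
rewrite Ew.
have -> : rev (glyphs (encode_points ((0, 0) :: points [::] cs)))
    = rev (glyphs (encode_points (points [::] cs))) ++ [:: commag; commag].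
  by rewrite /encode_points /= !rev_cons -!cats1 -catA.
apply: exec_le (exec_seq (Hskip _ isT) (exec_seq Hmove (exec_seq (Hcopy _)
  (exec_seq (Hrw0 _ isT) (exec_seq (Hrw1 _ isT) (exec_seq Hput1
  (exec_seq Hput2 Hall))))))) _.
- by rewrite all_rcons all_num.
- exact: L_code.
- exact: L_code.
- exact: L_code.
have le_cs : size cs <= size L.
  by have := size_le_list_code (unmarked cs); rewrite size_map.
set N := (size (rcons (num n) commag ++ semig :: L ++ semig :: r0)).+1.
have lt_N : size (rcons (num n) commag) + size L < N.
  by rewrite /N !size_cat /= size_cat /=; clear; lia.
(* There are fewer than [N] rounds of quadratic length, whence the cube; the passes before the
   rounds are linear and fit into the remaining multiple of [N ^ 3]. *)
have le_all : size cs * (100 * (size L).+1 ^ 2).+1 <= 101 * N ^ 3.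
  have le_2 : (size L).+1 ^ 2 <= N ^ 2.
    by rewrite leq_exp2r //; move: lt_N; clear; lia.
  have N2_gt0 : 0 < N ^ 2 by rewrite expn_gt0.
  rewrite (expnS N 2) mulnCA leq_mul //; last by move: le_2 N2_gt0; clear; lia.
  by move: le_cs lt_N; clear; lia.
have le_N3 : N <= N ^ 3 by rewrite -{1}[N]expn1 leq_pexp2l //.
move: le_all le_N3 lt_N; clear.
by move: N (size L) (size (rcons _ _)) (N ^ 3) (size cs * _); lia.
Qed.

(** * Efficient solutions *)

Definition cheapest (T : finType) (c : T -> nat) (F : {set T}) : Prop :=
  forall x y, x \in F -> y \notin F -> c x <= c y.

Lemma cheapest_sum (T : finType) (c : T -> nat) (F G : {set T}) :
  cheapest c F -> #|F| <= #|G| -> \sum_(x in F) c x <= \sum_(x in G) c x.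
Proof.
(* [b] separates the two differences: it is at least every cost in [F :\: G] and, [F] being
   cheapest, at most every cost in [G :\: F]. If [F :\: G] is empty, it is 0. *)
move=> cF le_FG; pose b := \max_(x in F :\: G) c x.
rewrite (big_setID G) [leqRHS](big_setID F) /= setIC leq_add2l.
have le_D : #|F :\: G| <= #|G :\: F|.
  by rewrite -(leq_add2l #|F :&: G|) cardsID setIC cardsID.
apply: (@leq_trans (#|F :\: G| * b)).
  by rewrite -sum_nat_const leq_sum // => x xFG; apply: leq_bigmax_cond.
apply: (@leq_trans (#|G :\: F| * b)); first by rewrite leq_mul2r le_D orbT.
rewrite -sum_nat_const leq_sum // => y /setDP[_ yF].
by apply/bigmax_leqP => x /setDP[xF _]; apply: cF.
Qed.

(** Drop any element of [G]: at least [#|F|] elements are left, and the dropped one had a positive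
    cost. *)
Lemma cheapest_sum_lt (T : finType) (c : T -> nat) (F G : {set T}) :
  (forall x, 0 < c x) -> cheapest c F -> #|F| < #|G| ->
  \sum_(x in F) c x < \sum_(x in G) c x.
Proof.
move=> c_gt0 cF lt_FG; have /card_gt0P[x xG] : 0 < #|G|.
  by apply: leq_trans lt_FG.
have -> : \sum_(y in G) c y = c x + \sum_(y in G :\ x) c y.
  by rewrite (bigD1 x) //=;
    under [in RHS]eq_bigl => y do rewrite in_setD1 andbC.
have : \sum_(y in F) c y <= \sum_(y in G :\ x) c y.
  by apply: cheapest_sum => //; rewrite (cardsD1 x G) xG in lt_FG.
by have := c_gt0 x; lia.
Qed.

(** Exchanging the sums over OD pairs and over segments makes each segment of [F] contribute its
    weight. *)
Lemma attracted_card (R : realType) (I : instance R)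
    (F : {set 'I_(stations I).-1}) :
  (forall e : 'I_(stations I).-1, weight e = 1%R) -> attracted F = #|F|%:R%R.
Proof.
move=> w1; rewrite -sumr_const -(eq_bigr _ (fun e _ => w1 e)).
rewrite /attracted /weight.
under [RHS]eq_bigr => e _ do rewrite big_distrr.
rewrite /= (exchange_big_dep (mem (od I))) /=; last by move=> e d _ /andP[].
apply: eq_bigr => d dI; rewrite mulr_suml mulr_sumr.
apply: eq_big => [e|e _]; last by rewrite mulrCA.
by rewrite in_setI dI.
Qed.

Lemma cheapest_efficient (R : realType) (I : instance R)
    (F : {set 'I_(stations I).-1}) :
  (forall e : 'I_(stations I).-1, weight e = 1%R) -> cheapest (@cost R I) F ->
  efficient F (\sum_(e in F) cost e)%:R%R.
Proof.
move=> w1 cF; split; first by split; rewrite ?ler0n // natr_sum.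
case=> F' [v' [[_ le_v']]]; rewrite !attracted_card //
  ler_nat ltr_nat => le_F le_v.
have le_c : \sum_(e in F') cost e <= \sum_(e in F) cost e.
  by rewrite -(ler_nat R) natr_sum (le_trans le_v').
case=> [lt_F|].
  have := cheapest_sum_lt (@cost_gt0 R I) cF lt_F.
  by rewrite ltnNge le_c.
apply/negP; rewrite -leNgt (le_trans _ le_v') // -natr_sum ler_nat.
exact: cheapest_sum.
Qed.

(** A larger [v] would be dominated by [G], and a smaller one could not pay for [F]. A non-dominated
    point is therefore attained by any cheapest set of the right cardinality, which leaves the
    choice of a convenient one: an interval for connectedness, a set of predecessors for the
    machine. *)
Lemma efficient_cheapest (R : realType) (I : instance R)
    (F G : {set 'I_(stations I).-1}) v :
  (forall e : 'I_(stations I).-1, weight e = 1%R) ->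
  efficient F v -> cheapest (@cost R I) G -> #|G| = #|F| ->
  v = (\sum_(e in G) cost e)%:R%R.
Proof.
move=> w1 [[_ le_v] noF] cG eq_GF; apply/eqP; rewrite eq_le; apply/andP; split.
  rewrite leNgt; apply/negP => lt_v; apply: noF.
  exists G, (\sum_(e in G) cost e)%:R%R; split; last by right.
  - by split; rewrite ?ler0n // natr_sum.
  - by rewrite !attracted_card // eq_GF.
  - exact: ltW.
apply: le_trans le_v; rewrite -natr_sum ler_nat.
by apply: cheapest_sum; rewrite ?eq_GF.
Qed.

(** * Valleys *)

Definition segment_interval n (a b : nat) : {set 'I_n} :=
  [set e : 'I_n | a <= e < b].

Lemma card_interval n a b : b <= n -> #|segment_interval n a b| = b - a.
Proof.
move=> le_bn; have [le_ba|lt_ab] := leqP b a.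
  rewrite (_ : segment_interval n a b = set0) ?cards0; first by lia.
  by apply/setP => e; rewrite !inE; lia.
have Hn (i : 'I_(b - a)) : a + i < n by have := ltn_ord i; lia.
rewrite -[RHS]card_ord -(card_imset _ (f := fun i => Ordinal (Hn i)));
  last first.
  by move=> i j /(congr1 val) /= /addnI/val_inj.
apply: eq_card => e; rewrite inE; apply/idP/imsetP => [e_ab|[i _ ->] /=].
  have lt_e : e - a < b - a by lia.
  by exists (Ordinal lt_e) => //; apply: val_inj => /=; lia.
by have := ltn_ord i; lia.
Qed.

(** Keeping [m] inside the interval is what makes the greedy growth work: [f] then decreases up to
    the left end and increases from the right end on, so the two neighbours are minimal on their
    sides and the smaller one is minimal outside. *)
Lemma valley_interval (f : nat -> nat) n m k :
  (forall j j', j <= j' <= m -> f j' <= f j) ->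
  (forall j j', m <= j <= j' -> j' < n -> f j <= f j') ->
  m < n -> 0 < k <= n ->
  exists a b, [/\ a <= m < b, b <= n, b - a = k &
    forall x y, a <= x < b -> y < n -> ~~ (a <= y < b) -> f x <= f y].
Proof.
move=> dec inc lt_mn; case: k => // k /=; elim: k => [|k IH] le_k.
  exists m, m.+1; split=> //; [lia|lia|] => x y xm yn ym.
  have -> : x = m by lia.
  by case: (leqP m y) => ?; [apply: inc | apply: dec]; lia.
have [a [b [am_b le_bn Ek cF]]] := IH (ltnW le_k).
have [/andP[a_gt0 le_ab]|right] :=
  boolP ((0 < a) && ((b == n) || (f a.-1 <= f b))).
  exists a.-1, b; split=> //; [lia|lia|] => x y xab yn yab.
  have [Ex|Nx] := eqVneq x a.-1; last by apply: cF; lia.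
  rewrite Ex; have [le_by|lt_yb] := leqP b y; last by apply: dec; lia.
  case/orP: le_ab => [/eqP|le_ab]; first by lia.
  by apply: leq_trans le_ab _; apply: inc; lia.
(* If [b] were [n], the failed test would force [a = 0], and the interval would already have [n]
   elements instead of [k.+1 < n]. *)
have {}lt_bn : b < n by move: right; lia.
exists a, b.+1; split=> //; [lia|lia|] => x y xab yn yab.
have [Ex|Nx] := eqVneq x b; last by apply: cF; lia.
rewrite Ex; have [le_by|lt_yb] := leqP b y; first by apply: inc; lia.
have le_ba : f b <= f a.-1 by move: right; lia.
by apply: leq_trans le_ba _; apply: dec; lia.
Qed.

Lemma cheapest_interval n (c : 'I_n -> nat) (m : 'I_n) k :
  (forall j j' : 'I_n, j <= j' -> j' <= m -> c j' <= c j) ->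
  (forall j j' : 'I_n, m <= j -> j <= j' -> c j <= c j') ->
  k <= n ->
  exists a b, [/\ b <= n, b - a = k & cheapest c (segment_interval n a b)].
Proof.
(* The empty interval cannot contain [m], so it is treated apart. *)
move=> dec inc le_kn; case: (posnP k) => [->|k_gt0].
  by exists 0, 0; split=> // x y; rewrite inE; lia.
pose f i := c (insubd m i).
have valf i : i < n -> insubd m i = i :> nat by rewrite val_insubd => ->.
have [||||a [b [am_b le_bn Ek cF]]] := @valley_interval f n m k.
- move=> j j' /andP[le_j le_m]; have lt_m := ltn_ord m.
  by apply: dec; rewrite !valf; lia.
- move=> j j' /andP[le_m le_j] lt_n.
  by apply: inc; rewrite !valf; lia.
- exact: ltn_ord.
- by rewrite k_gt0.
exists a, b; split=> // x y; rewrite !inE => xab yab.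
by have := cF x y xab (ltn_ord y) yab; rewrite /f !valKd.
Qed.

(** [n_comp] counts the component roots among the nodes; as any two nodes are joined by walking
    along the line, two such roots coincide. The segments from [a] to [b - 1] touch the stations
    from [a] to [b], hence the closed bounds on stations below. *)
Lemma interval_connected n a b : segments_connected (segment_interval n.-1 a b).
Proof.
set F := segment_interval _ a b.
have adjP (x y : 'I_n) : a <= x -> x < b -> y = x.+1 :> nat ->
  adj F x y /\ adj F y x.
  move=> le_ax lt_xb Ey.
  have lt_x : x < n.-1 by have := ltn_ord y; lia.
  have Eends : ends (Ordinal lt_x) = [set x; y].
    by apply/setP => z; rewrite !inE -!val_eqE /= Ey.
  by split; apply/existsP; exists (Ordinal lt_x);
    rewrite inE /= le_ax lt_xb Eends //= setUC.
(* Induction on the distance, carrying both directions because [connect] is a directed notion. *)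
have conn k (x y : 'I_n) : a <= x -> y = x + k :> nat -> y <= b ->
  connect (adj F) x y /\ connect (adj F) y x.
  elim: k y => [|k IH] y le_ax Ey le_yb.
    by have -> : y = x by apply: val_inj; rewrite /= Ey addn0.
  have lt_z : x + k < n by have := ltn_ord y; lia.
  have [||xz zx] := IH (Ordinal lt_z) le_ax => //=; first by lia.
  have [|||zy yz] := adjP (Ordinal lt_z) y => /=; try lia.
  split; first exact: connect_trans xz (connect1 zy).
  exact: connect_trans (connect1 yz) zx.
have nodesP x : x \in nodes F -> a <= x <= b.
  by case/bigcupP => e; rewrite !inE => eF /orP[] /eqP->; lia.
have connP x y : x \in nodes F -> y \in nodes F -> connect (adj F) x y.
  move=> /nodesP xab /nodesP yab; case: (leqP x y) => [le_xy|/ltnW le_yx].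
    by have [] := conn (y - x) x y; lia.
  by have [] := conn (x - y) y x; lia.
apply/card_le1_eqP => x y; rewrite !inE => /andP[/eqP rx xF] /andP[/eqP ry yF].
rewrite -rx -ry; apply/eqP; rewrite root_connect ?connP //.
apply: sym_connect_sym => u v; apply/existsP/existsP => -[e].
  by rewrite setUC; exists e.
by rewrite setUC; exists e.
Qed.

(** * The listed points *)

Definition point (cs : seq nat) (j : nat) : nat * nat :=
  let its := marked (take j.+1 cs) ++ unmarked (drop j.+1 cs) in
  (rank_upto (nth 0 cs j) its, sum_upto (nth 0 cs j) its).

Lemma pointsE pre suf :
  points pre suf = [seq point (pre ++ suf) j | j <- iota (size pre) (size suf)].
Proof.
elim: suf pre => //= c suf IH pre; rewrite IH cat_rcons size_rcons; congr cons.
have E : (size pre).+1 = size (rcons pre c) by rewrite size_rcons.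
by rewrite /point -cat_rcons E take_size_cat // drop_size_cat //
  nth_cat E leqnn nth_rcons ltnn eqxx.
Qed.

(** The elements up to and including [j] in the lexicographic order of the pairs [(c i, i)];
    [i <= j] is the mark carried by [i] in the round of [j]. *)
Definition initial_segment (m : nat) (c : 'I_m -> nat) (j : 'I_m) :
    {set 'I_m} :=
  [set i | precedes (c j) (c i, i <= j)].

Lemma marks_image m (c : 'I_m -> nat) (j : 'I_m) :
  let cs := [seq c i | i : 'I_m] in
  marked (take j.+1 cs) ++ unmarked (drop j.+1 cs)
    = [seq (c i, i <= j) | i : 'I_m].
Proof.
set cs := [seq c i | i : 'I_m] => /=.
have size_cs : size cs = m by rewrite size_map size_enum_ord.
have size_take : size (take j.+1 cs) = j.+1.
  by rewrite size_takel // size_cs ltn_ord.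
apply: (@eq_from_nth _ (0, false)) => [|i].
  by rewrite size_image card_ord size_cat 2!size_map size_drop size_take
    size_cs subnKC.
rewrite size_cat 2!size_map size_drop size_take size_cs subnKC ?ltn_ord //
  => lt_i.
rewrite -[i in RHS]/(nat_of_ord (Ordinal lt_i)) nth_image_ord /=.
rewrite nth_cat size_map size_take ltnS; case: leqP => le_ij.
  by rewrite (nth_map 0) ?size_take // nth_take //
    (nth_image_ord _ _ (Ordinal lt_i)).
rewrite (nth_map 0) ?size_drop ?size_cs ?ltn_sub2r //;
  last exact: leq_trans lt_i.
by rewrite nth_drop subnKC // (nth_image_ord _ _ (Ordinal lt_i)).
Qed.

Lemma point_image m (c : 'I_m -> nat) (j : 'I_m) :
  point [seq c i | i : 'I_m] j
    = (#|initial_segment c j|, \sum_(i in initial_segment c j) c i).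
Proof.
rewrite /point marks_image (nth_image_ord _ _ j) /rank_upto /sum_upto.
congr pair; last first.
  by rewrite big_map big_enum_cond; apply: eq_bigl => i; rewrite !inE.
rewrite -sum1_count big_map big_enum_cond -sum1_card.
by apply: eq_bigl => i; rewrite !inE.
Qed.

Lemma cheapest_initial_segment m (c : 'I_m -> nat) (j : 'I_m) :
  cheapest c (initial_segment c j).
Proof. by move=> x y; rewrite !inE /precedes /=; lia. Qed.

(** The rank increases strictly along a total order, so rank minus one is an injective map from
    ['I_m] to itself; by finiteness it is onto. *)
Lemma card_initial_segment m (c : 'I_m -> nat) k :
  0 < k <= m -> exists j, #|initial_segment c j| = k.
Proof.
move=> /andP[k_gt0 le_km].
have self j : j \in initial_segment c j.
  by rewrite inE /precedes /= eqxx leqnn orbT.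
have [n En] : exists n : 'I_m -> nat, forall j, n j = #|initial_segment c j|.
  by eexists.
have n_gt0 j : 0 < n j by rewrite En; apply/card_gt0P; exists j.
have n_le j : n j <= m.
  by have := subset_leq_card (subsetT (initial_segment c j));
    rewrite cardsT card_ord En.
have incr i j : precedes (c j) (c i, i <= j) -> i != j -> n i < n j.
  move=> ij ne_ij; rewrite !En; apply: proper_card; apply/properP; split.
    by apply/subsetP => x; move: ij; rewrite !inE /precedes /=; lia.
  exists j; rewrite // inE; move: ij ne_ij; rewrite /precedes -val_eqE /=; lia.
have lt_n j : (n j).-1 < m by have := n_le j; have := n_gt0 j; lia.
pose f j : 'I_m := Ordinal (lt_n j).
have f_inj : injective f.
  move=> i j /(congr1 val) /= Eij; apply/eqP; apply: contraT => ne_ij.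
  have := n_gt0 i; have := n_gt0 j.
  have [ij|ji] : precedes (c j) (c i, i <= j) \/ precedes (c i) (c j, j <= i).
  - by rewrite /precedes /=; lia.
  - by have := incr _ _ ij ne_ij; lia.
  - by rewrite eq_sym in ne_ij; have := incr _ _ ji ne_ij; lia.
have lt_k : k.-1 < m by lia.
have [g _ gK] := injF_bij f_inj.
exists (g (Ordinal lt_k)); rewrite -En; have /(congr1 val) /= :=
  gK (Ordinal lt_k).
by have := n_gt0 (g (Ordinal lt_k)); lia.
Qed.

(** An efficient [F] has the same point as the initial segment with [#|F|] elements, or as the empty
    set; conversely, all these sets are cheapest and thus efficient. *)
Lemma nondominated_points (R : realType) (I : instance R) (x y : R) :
  (forall e : 'I_(stations I).-1, weight e = 1%R) ->
  nondominated I x y <->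
    exists2 pv,
      pv \in (0, 0) :: points [::] [seq cost e | e : 'I_(stations I).-1]
              & x = pv.1%:R%R /\ y = pv.2%:R%R.
Proof.
move=> w1; set c := @cost R I; set cs := [seq _ | e : _].
have size_cs : size cs = (stations I).-1 by rewrite size_map size_enum_ord.
rewrite pointsE /= size_cs; split.
  case=> F [v [eff -> ->]]; rewrite attracted_card //.
  have [E0|F_gt0] := posnP #|F|.
    exists (0, 0); rewrite ?mem_head // E0; split=> //.
    rewrite (efficient_cheapest (G := set0) w1 eff) ?cards0 ?big_set0 //.
    by move=> i j; rewrite inE.
  have [|j Ej] := @card_initial_segment _ c #|F|.
    by rewrite F_gt0 -[leqRHS]card_ord max_card.
  exists (point cs j).
    by rewrite inE map_f ?orbT // mem_iota /=.
  rewrite point_image /= Ej; split=> //.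
  exact: efficient_cheapest w1 eff (@cheapest_initial_segment _ c j) Ej.
suff cheap_point F : cheapest c F ->
  nondominated I #|F|%:R%R (\sum_(e in F) c e)%:R%R.
  case=> pv + [-> ->]; rewrite inE => /predU1P[->|/mapP[j]].
    have := cheap_point set0; rewrite cards0 big_set0; apply.
    by move=> i j; rewrite inE.
  rewrite mem_iota /= => lt_j ->.
  rewrite -[j]/(nat_of_ord (Ordinal lt_j)) point_image.
  by apply: cheap_point; apply: cheapest_initial_segment.
move=> cF; exists F, (\sum_(e in F) c e)%:R%R; rewrite attracted_card //.
by split=> //; apply: cheapest_efficient.
Qed.

(** * Polynomial time on encoded instances *)

Lemma glyphs_encoding (R : realType) (rho : R -> seq bool) (I : instance R) :
  exists r0, glyphs (encode_instance rho I)
    = num (stations I) ++ commag :: semig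
      :: list_code (unmarked [seq cost e | e : 'I_(stations I).-1])
         ++ semig :: r0.
Proof.
have glyphs_number n : glyphs (Defs.number n) = rcons (num n) commag.
  by rewrite /glyphs /Defs.number /field map_rcons -map_comp.
eexists; rewrite /encode_instance {1}/glyphs map_cat -/(glyphs _) glyphs_number.
rewrite cat_rcons /= map_cat /=; congr (_ ++ _ :: _ :: _ ++ _ :: _).
rewrite /image_mem; elim: (enum 'I_(stations I).-1) => //= e s IH.
by rewrite map_cat -/(glyphs _) glyphs_number IH.
Qed.

Lemma nondominated_poly_time (R : realType) (rho : R -> seq bool) :
  poly_time_solvable
    (fun I : instance R => forall e : 'I_(stations I).-1, weight e = 1%R)
    (encode_instance rho) (@lists_nondominated R).
Proof.
exists (machine_of 5 solver), (200%:P * ('X + 1%:P) ^+ 3)%R => I w1.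
pose cs := [seq cost e | e : 'I_(stations I).-1].
have [r0 Er0] := glyphs_encoding rho I.
have [T0 [T1 Hs]] := exec_solver (stations I) cs r0.
rewrite -Er0 size_map in Hs.
have [t le_t Ht] := exec_outputs (k := 5)
  (z := encode_points ((0, 0) :: points [::] cs)) Hs erefl.
exists t, (encode_points ((0, 0) :: points [::] cs)); split=> //.
  apply: leq_trans le_t _.
  by rewrite !hornerE !ssralg.natrE addn1.
by exists ((0, 0) :: points [::] cs) => // x y; apply: nondominated_points.
Qed.

Local Open Scope ring_scope.

Theorem lemma13 (R : realType) :
  [/\ (* 1 *)
      forall (I : instance R) (sigma : {perm 'I_(stations I).-1}),
        (forall e : 'I_(stations I).-1, weight e = 1) ->
        (forall i j : 'I_(stations I).-1,
           (i <= j)%N -> (cost (sigma i) <= cost (sigma j))%N) ->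
        forall (k : nat) (v : R) (F : {set 'I_(stations I).-1}),
          (k <= (stations I).-1)%N ->
          v = \sum_(i < (stations I).-1 | (i < k)%N) (cost (sigma i))%:R ->
          F = [set sigma i | i : 'I_(stations I).-1 & (i < k)%N] ->
          efficient F v,
      (* 2 *)
      forall I : instance R,
        (forall e : 'I_(stations I).-1, weight e = 1) ->
        (exists m : 'I_(stations I).-1,
           (forall j j' : 'I_(stations I).-1,
              (j <= j')%N -> (j' <= m)%N -> (cost j >= cost j')%N) /\
           (forall j j' : 'I_(stations I).-1,
              (m <= j)%N -> (j <= j')%N -> (cost j <= cost j')%N)) ->
        forall x y : R, nondominated I x y ->
          exists (F : {set 'I_(stations I).-1}) (v : R),
            [/\ efficient F v, x = attracted F, y = v & segments_connected F]
    & (* 3 *)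
      forall rho : R -> seq bool,
        poly_time_solvable
          (fun I : instance R =>
             forall e : 'I_(stations I).-1, weight e = 1)
          (encode_instance rho) (@lists_nondominated R)].
Proof.
split.
- move=> I sigma w1 sorted_sigma k v F _ -> ->.
  have -> : \sum_(i < (stations I).-1 | (i < k)%N) (cost (sigma i))%:R
      = (\sum_(e in [set sigma i | i : 'I_(stations I).-1 & (i < k)%N])
           cost e)%:R :> R.
    rewrite natr_sum big_imset /=; last by move=> i j _ _; apply: perm_inj.
    by apply: eq_bigl => i; rewrite !inE.
  apply: cheapest_efficient => // e e' /imsetP[i lt_ik ->].
  (* Writing [e'] as the image of its position in the sorting turns non-membership into a position
     at least [k]. *)
  rewrite -[e'](permKV sigma) (mem_imset _ _ perm_inj) => le_kj.
  by apply: sorted_sigma; move: lt_ik le_kj; rewrite !inE; lia.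
(* The given [F] need not be connected; it is replaced by a cheapest interval of the same
   cardinality, which attains the same point. *)
- move=> I w1 [m [dec inc]] x y [F [v [eff -> ->]]].
  have le_F : (#|F| <= (stations I).-1)%N by rewrite -[leqRHS]card_ord max_card.
  have [a [b [le_b Eab cG]]] := cheapest_interval dec inc le_F.
  have EF : #|segment_interval (stations I).-1 a b| = #|F|.
    by rewrite card_interval.
  exists (segment_interval (stations I).-1 a b), v; split=> //.
  + by rewrite (efficient_cheapest w1 eff cG EF); apply: cheapest_efficient.
  + by rewrite !attracted_card // EF.
  + exact: interval_connected.
- exact: nondominated_poly_time.
Qed.
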